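(* Let $\mathcal G$ be a finite simplicial graph with vertex set $I$, let $(G_i)_{i\in I}$ be finite groups, let $\Gamma=\Gamma(\mathcal G,(G_i)_{i\in I})$ be the graph product and $\Delta=\Delta(\mathcal G,(G_i)_{i\in I})$ the associated right-angled building. Suppose $\Delta$ is Gromov-hyperbolic. If $\Gamma'\subset \mathrm{Aut}_0(\Delta)$ is a uniform lattice all of whose quasiconvex subgroups are separable in $\Gamma'$, then $\Gamma'$ is commensurable to $\Gamma$ in $\mathrm{Aut}_0(\Delta)$.
   Context: Graph product: $\Gamma(\mathcal G,(G_i))$ is the quotient of the free product $\ast_{i\in I}G_i$ by the normal subgroup generated by all commutators $g_ig_jg_i^{-1}g_j^{-1}$, $g_i\in G_i$, $g_j\in G_j$, with $i\ne j$ adjacent in $\mathcal G$. For $J\subset I$, $\Gamma_J$ is the subgroup of $\Gamma$ generated by the $G_j$, $j\in J$ (so $\Gamma_\emptyset=1$). Building: call $\sigma\subset I$ spherical if its elements are pairwise adjacent (the empty set and singletons included). In the real Hilbert space with orthonormal basis $(e_i)_{i\in I}$ let $C$ be the cube complex that is the union over finite spherical $\sigma$ of the unit cubes $\{\sum_{i\in\sigma}x_ie_i: 0\le x_i\le 1\}$ (together with their faces). Its vertices are $v_J=\sum_{i\in J}e_i$, $J$ finite spherical. For $x\in C$ put $\underline t(x)=\{i: x_i=1\}$. Then $\Delta=(\Gamma\times C)/\sim$ where $(\gamma,x)\sim(\gamma',x')$ iff $x=x'$ and $\gamma^{-1}\gamma'\in\Gamma_{\underline t(x)}$, with the cube complex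 structure whose cubes are the images of the sets $\{\gamma\}\times Q$, $Q$ a cube of $C$. It carries the length metric that makes every cube a unit Euclidean cube. The type of the vertex $[\gamma,v_J]$ is $J$. $\mathrm{Aut}_0(\Delta)$ is the group of combinatorial automorphisms of $\Delta$ preserving types of vertices. $\Gamma$ acts on $\Delta$ by left multiplication, faithfully, and is regarded as a subgroup of $\mathrm{Aut}_0(\Delta)$. A uniform lattice is a subgroup $\Gamma'\subset\mathrm{Aut}_0(\Delta)$ with finite vertex stabilizers and finitely many orbits of vertices. Subgroups $\Gamma_1,\Gamma_2$ of a group $G$ are commensurable in $G$ if for some $g\in G$ the group $g\Gamma_1g^{-1}\cap\Gamma_2$ has finite index in both $g\Gamma_1g^{-1}$ and $\Gamma_2$. A subgroup $\Lambda$ of a Gromov-hyperbolic group is quasiconvex if geodesics (of a Cayley graph for a finite generating set) between elements of $\Lambda$ stay at uniformly bounded distance from $\Lambda$. A subgroup $\Lambda$ of $\Gamma'$ is separable if it is the intersection of all finite index subgroups of $\Gamma'$ containing it. *)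

(* Defs.v *)
From HB Require Import structures.
From mathcomp Require Import all_boot all_order all_fingroup all_algebra generic_quotient.
From mathcomp Require Import boolp classical_sets cardinality reals.

Set Implicit Arguments.
Unset Strict Implicit.
Unset Printing Implicit Defensive.

Import Order.TTheory GRing.Theory Num.Theory.
Local Open Scope classical_set_scope.

(** * Subgroups of arbitrary groups *)

Section Subgroups.
Variable G : groupType.
Implicit Types (x y : G) (S H K L : set G).

Definition subgroup H : Prop :=
  [/\ H 1%g, forall x y, H x -> H y -> H (x * y)%g & forall x, H x -> H x^-1%g].

Definition normal_subgroup H : Prop :=
  subgroup H /\ forall x y, H x -> H (y^-1 * x * y)%g.

Definition generated S : set G :=
  \bigcap_(H in [set H | subgroup H /\ S `<=` H]) H.

Definition normal_closure S : set G :=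
  \bigcap_(H in [set H | normal_subgroup H /\ S `<=` H]) H.

Definition finite_index H K : Prop :=
  H `<=` K /\ finite_set [set [set (k * h)%g | h in H] | k in K].

Definition conj_set (g : G) H : set G := [set (g * h * g^-1)%g | h in H].

Definition commensurable H K : Prop :=
  exists g : G,
    finite_index (conj_set g H `&` K) (conj_set g H) /\
    finite_index (conj_set g H `&` K) K.

Definition separable_in K L : Prop :=
  L = \bigcap_(H in [set H | [/\ subgroup H, finite_index H K & L `<=` H]]) H.

(* Edge paths of the Cayley graph of [S]: consecutive vertices of [x :: p]
   differ by right multiplication by an element of [S] or its inverse. *)
Fixpoint cayley_path S x (p : seq G) : Prop :=
  if p is y :: p' then
    (S (x^-1 * y)%g \/ S (y^-1 * x)%g) /\ cayley_path S y p'
  else True.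

Definition cayley_geodesic S x (p : seq G) : Prop :=
  cayley_path S x p /\
  forall q, cayley_path S x q -> last x q = last x p -> (size p <= size q)%N.

(* Only the vertices of geodesics are considered; the other points of a
   geodesic are at distance at most 1/2 from a vertex. *)
Definition quasiconvex_in K L : Prop :=
  exists S, [/\ finite_set S, generated S = K &
    exists D : nat, forall x p, L x -> cayley_geodesic S x p -> L (last x p) ->
      forall y, y \in x :: p ->
        exists q, [/\ cayley_path S y q, L (last y q) & (size q <= D)%N]].

Lemma generated_subgroup S : subgroup (generated S).
Proof.
split=> [H [[]]|x y Hx Hy H HS|x Hx H HS] //.
  by case: (HS) => -[_ HM _] _; apply: HM; [exact: Hx|exact: Hy].
by case: (HS) => -[_ _ HV] _; apply: HV; exact: Hx.
Qed.

Lemma normal_closure_normal S : normal_subgroup (normal_closure S).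
Proof.
split; first split=> [H [[[]]]|x y Hx Hy H HS|x Hx H HS] //.
- by case: (HS) => -[[_ HM _] _] _; apply: HM; [exact: Hx|exact: Hy].
- by case: (HS) => -[[_ _ HV] _] _; apply: HV; exact: Hx.
by move=> x y Hx H HS; case: (HS) => -[_ HJ] _; apply: HJ; exact: Hx.
Qed.

End Subgroups.

(** * Quotient of a group by the normal closure of a set *)

Section QuotientGroup.
Variables (G : groupType) (S : set G).
Implicit Types x y z : G.

Definition ncl_rel : rel G := fun x y => `[< normal_closure S (x^-1 * y)%g >].

Lemma ncl_relP : equiv_class_of ncl_rel.
Proof.
have [[H1 HM HV] _] := normal_closure_normal S.
split=> [x|x y|y x z].
- by apply/asboolP; rewrite mulVg.
- by apply/asboolP/asboolP => /HV; rewrite invgM invgK.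
move=> /asboolP xy /asboolP yz; apply/asboolP.
by have := HM _ _ xy yz; rewrite mulgA mulgK.
Qed.

Canonical ncl_equiv := EquivRelPack ncl_relP.

Definition ncl_quotient := {eq_quot ncl_equiv}%qT.
HB.instance Definition _ := Choice.on ncl_quotient.

Definition ncl_proj (x : G) : ncl_quotient := (\pi_({eq_quot ncl_equiv}) x)%qT.
Definition ncl_repr (a : ncl_quotient) : G :=
  repr (a : {eq_quot ncl_equiv}%qT).

Lemma ncl_reprK : cancel ncl_repr ncl_proj.
Proof. exact: reprK. Qed.

Lemma ncl_projP x y : ncl_proj x = ncl_proj y <-> normal_closure S (x^-1 * y)%g.
Proof.
split=> [/eqP|xy].
  by rewrite /ncl_proj -[_ == _]/(_ == _ %[mod _])%qT eqmodE => /asboolP.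
by apply/eqP; rewrite /ncl_proj -[_ == _]/(_ == _ %[mod _])%qT eqmodE; apply/asboolP.
Qed.

Lemma ncl_reprP x : normal_closure S (x^-1 * ncl_repr (ncl_proj x))%g.
Proof. by apply/ncl_projP; rewrite ncl_reprK. Qed.

Definition ncl_one : ncl_quotient := ncl_proj 1%g.
Definition ncl_mul (a b : ncl_quotient) := ncl_proj (ncl_repr a * ncl_repr b)%g.
Definition ncl_inv (a : ncl_quotient) := ncl_proj (ncl_repr a)^-1%g.

Lemma ncl_projM x y : ncl_proj (x * y)%g = ncl_mul (ncl_proj x) (ncl_proj y).
Proof.
have [[H1 HM HV] HJ] := normal_closure_normal S.
apply/ncl_projP; rewrite invgM.
set x' := ncl_repr _; set y' := ncl_repr _.
have -> : (y^-1 * x^-1 * (x' * y') = (y^-1 * (x^-1 * x') * y) * (y^-1 * y'))%g.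
  by rewrite !mulgA mulgK.
by apply: HM; [apply: HJ|]; exact: ncl_reprP.
Qed.

Lemma ncl_projV x : ncl_proj x^-1%g = ncl_inv (ncl_proj x).
Proof.
have [[H1 HM HV] HJ] := normal_closure_normal S.
apply/ncl_projP; rewrite invgK.
have -> : (x * (ncl_repr (ncl_proj x))^-1 =
           x^-1^-1 * (x^-1 * ncl_repr (ncl_proj x))^-1 * x^-1)%g.
  by rewrite invgM !invgK mulgA mulgK.
by apply: HJ; apply: HV; exact: ncl_reprP.
Qed.

Lemma ncl_mulA : associative ncl_mul.
Proof.
by move=> a b c; rewrite -[a]ncl_reprK -[b]ncl_reprK -[c]ncl_reprK -!ncl_projM mulgA.
Qed.

Lemma ncl_mul1 : left_id ncl_one ncl_mul.
Proof. by move=> a; rewrite -[a]ncl_reprK -ncl_projM mul1g. Qed.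

Lemma ncl_mulr1 : right_id ncl_one ncl_mul.
Proof. by move=> a; rewrite -[a]ncl_reprK -ncl_projM mulg1. Qed.

Lemma ncl_mulV : left_inverse ncl_one ncl_inv ncl_mul.
Proof. by move=> a; rewrite -[a]ncl_reprK -ncl_projV -ncl_projM mulVg. Qed.

Lemma ncl_mulrV : right_inverse ncl_one ncl_inv ncl_mul.
Proof. by move=> a; rewrite -[a]ncl_reprK -ncl_projV -ncl_projM mulgV. Qed.

HB.instance Definition _ := isGroup.Build ncl_quotient
  ncl_mulA ncl_mul1 ncl_mulr1 ncl_mulV ncl_mulrV.

End QuotientGroup.

(** * Free products *)

Section FreeProduct.
Variables (I : finType) (G : I -> finGroupType).

Definition letter := {i : I & G i}.
Definition lett (i : I) (g : G i) : letter := Tagged G g.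

Inductive fp_eq : seq letter -> seq letter -> Prop :=
| FpRefl u : fp_eq u u
| FpSym u v : fp_eq u v -> fp_eq v u
| FpTrans v u w : fp_eq u v -> fp_eq v w -> fp_eq u w
| FpCat u u' v v' : fp_eq u u' -> fp_eq v v' -> fp_eq (u ++ v) (u' ++ v')
| FpOne i : fp_eq [:: @lett i 1%g] [::]
| FpMul i (g h : G i) : fp_eq [:: lett g; lett h] [:: lett (g * h)%g].

Definition fp_rel : rel (seq letter) := fun u v => `[< fp_eq u v >].

Lemma fp_relP : equiv_class_of fp_rel.
Proof.
split=> [u|u v|v u w].
- by apply/asboolP; exact: FpRefl.
- by apply/asboolP/asboolP; exact: FpSym.
by move=> /asboolP uv /asboolP vw; apply/asboolP; exact: FpTrans uv vw.
Qed.

Canonical fp_equiv := EquivRelPack fp_relP.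

Definition free_product := {eq_quot fp_equiv}%qT.
HB.instance Definition _ := Choice.on free_product.

Definition fp_proj (u : seq letter) : free_product :=
  (\pi_({eq_quot fp_equiv}) u)%qT.
Definition fp_repr (a : free_product) : seq letter :=
  repr (a : {eq_quot fp_equiv}%qT).

Lemma fp_reprK : cancel fp_repr fp_proj.
Proof. exact: reprK. Qed.

Lemma fp_projP u v : fp_proj u = fp_proj v <-> fp_eq u v.
Proof.
split=> [/eqP|uv].
  by rewrite /fp_proj -[_ == _]/(_ == _ %[mod _])%qT eqmodE => /asboolP.
by apply/eqP; rewrite /fp_proj -[_ == _]/(_ == _ %[mod _])%qT eqmodE; apply/asboolP.
Qed.

Lemma fp_reprP u : fp_eq u (fp_repr (fp_proj u)).
Proof. by apply/fp_projP; rewrite fp_reprK. Qed.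

Definition letter_inv (a : letter) : letter := lett (tagged a)^-1%g.
Definition word_inv (u : seq letter) := rev (map letter_inv u).

Definition fp_one : free_product := fp_proj [::].
Definition fp_mul (a b : free_product) := fp_proj (fp_repr a ++ fp_repr b).
Definition fp_inv (a : free_product) := fp_proj (word_inv (fp_repr a)).

Lemma word_invK : involutive word_inv.
Proof.
move=> u; rewrite /word_inv map_rev revK -map_comp map_id_in // => -[i g] _ /=.
by rewrite /letter_inv /= invgK.
Qed.

Lemma word_inv_cat u v : word_inv (u ++ v) = word_inv v ++ word_inv u.
Proof. by rewrite /word_inv map_cat rev_cat. Qed.

Lemma fp_eq_inv u v : fp_eq u v -> fp_eq (word_inv u) (word_inv v).
Proof.
elim=> {u v} [u|u v _|v u w _ uv _ vw|u u' v v' _ uu _ vv|i|i g h].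
- exact: FpRefl.
- exact: FpSym.
- exact: FpTrans uv vw.
- by rewrite !word_inv_cat; exact: FpCat.
- by rewrite /word_inv /= /letter_inv /= invg1; exact: FpOne.
by rewrite /word_inv /= /letter_inv /= invgM; exact: FpMul.
Qed.

Lemma fp_projM u v : fp_proj (u ++ v) = fp_mul (fp_proj u) (fp_proj v).
Proof. by apply/fp_projP/FpCat; exact: fp_reprP. Qed.

Lemma fp_projV u : fp_proj (word_inv u) = fp_inv (fp_proj u).
Proof. by apply/fp_projP/fp_eq_inv; exact: fp_reprP. Qed.

Lemma fp_eqV u : fp_eq (word_inv u ++ u) [::].
Proof.
elim: u => [|[i g] u IHu]; first exact: FpRefl.
rewrite -cat1s word_inv_cat -catA (catA (word_inv [:: _])).
apply: FpTrans IHu; apply: FpCat; first exact: FpRefl.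
rewrite -[X in fp_eq _ X]cat0s; apply: FpCat; last exact: FpRefl.
apply: (FpTrans (FpMul _ _)); rewrite mulVg; exact: FpOne.
Qed.

Lemma fp_mulA : associative fp_mul.
Proof.
by move=> a b c; rewrite -[a]fp_reprK -[b]fp_reprK -[c]fp_reprK -!fp_projM catA.
Qed.

Lemma fp_mul1 : left_id fp_one fp_mul.
Proof. by move=> a; rewrite -[a]fp_reprK -fp_projM. Qed.

Lemma fp_mulr1 : right_id fp_one fp_mul.
Proof. by move=> a; rewrite -[a]fp_reprK -fp_projM cats0. Qed.

Lemma fp_mulV : left_inverse fp_one fp_inv fp_mul.
Proof.
by move=> a; rewrite -[a]fp_reprK -fp_projV -fp_projM; apply/fp_projP/fp_eqV.
Qed.

Lemma fp_mulrV : right_inverse fp_one fp_inv fp_mul.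
Proof.
move=> a; rewrite -[a]fp_reprK -fp_projV -fp_projM; apply/fp_projP.
by rewrite -{1}(word_invK (fp_repr a)); exact: fp_eqV.
Qed.

HB.instance Definition _ := isGroup.Build free_product
  fp_mulA fp_mul1 fp_mulr1 fp_mulV fp_mulrV.

Definition fp_inj (i : I) (g : G i) : free_product := fp_proj [:: lett g].

End FreeProduct.

(** * Graph products *)

Section GraphProduct.
Variables (I : finType) (e : rel I) (G : I -> finGroupType).

Definition gp_relators : set (free_product G) :=
  [set w | exists i j (g : G i) (h : G j), [/\ i <> j, e i j &
     w = (fp_inj g * fp_inj h * (fp_inj g)^-1 * (fp_inj h)^-1)%g]].

Definition graph_product : groupType := ncl_quotient gp_relators.

Definition gp_inj (i : I) (g : G i) : graph_product :=
  ncl_proj gp_relators (fp_inj g).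

(* The subgroup Gamma_J. *)
Definition gp_sub (J : {set I}) : set graph_product :=
  generated [set a | exists2 j, j \in J & exists g : G j, a = gp_inj g].

End GraphProduct.

(** * The right-angled building *)

Section Building.
Variables (R : realType) (I : finType) (e : rel I) (G : I -> finGroupType).
Local Open Scope ring_scope.
Implicit Types (J K : {set I}) (x y : {ffun I -> R}).

Definition spherical (J : {set I}) : Prop :=
  forall i j, i \in J -> j \in J -> i != j -> e i j.

(* [cube_face J K] is the face of the unit cube on [K] in which the coordinates
   indexed by [J] are equal to 1: its vertices are the v_L, J <= L <= K. *)
Definition cube_face J K : set {ffun I -> R} :=
  [set x | forall i, [/\ 0 <= x i <= 1, i \in J -> x i = 1 & i \notin K -> x i = 0]].

Definition in_chamber x : Prop := exists2 K, spherical K & cube_face finset.set0 K x.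

Definition chamber := {x : {ffun I -> R} | `[< in_chamber x >]}.

Definition vtx J : {ffun I -> R} := [ffun i => (i \in J)%:R].

Definition ones x : {set I} := [set i | x i == 1]%SET.

Definition prebuilding := (graph_product e G * chamber)%type.

Definition bldg_rel : rel prebuilding := fun p q =>
  `[< p.2 = q.2 /\ gp_sub (ones (val p.2)) (p.1^-1 * q.1)%g >].

Lemma bldg_relP : equiv_class_of bldg_rel.
Proof.
have subgp J : subgroup (gp_sub (e := e) (G := G) J) by exact: generated_subgroup.
have sym p q : bldg_rel p q -> bldg_rel q p.
  case: p q => [g c] [h d] /asboolP[/= -> gh]; apply/asboolP; split=> //=.
  by case: (subgp (ones (val d))) => _ _ /(_ _ gh); rewrite invgM invgK.
split=> [[g c]|p q|[h d] [g c] [k b]].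
- by apply/asboolP; split=> //=; rewrite mulVg; case: (subgp (ones (val c))).
- by apply/idP/idP; exact: sym.
move=> /asboolP[/= cd gh] /asboolP[/= db hk]; subst d b.
apply/asboolP; split=> //=; case: (subgp (ones (val c))) => _ HM _.
by have := HM _ _ gh hk; rewrite mulgA mulgK.
Qed.

Canonical bldg_equiv := EquivRelPack bldg_relP.

Definition building := {eq_quot bldg_equiv}%qT.
HB.instance Definition _ := Choice.on building.

(* The point [g, c] of the building. *)
Definition bpt (g : graph_product e G) (c : chamber) : building :=
  (\pi_({eq_quot bldg_equiv}) (g, c))%qT.

Definition brepr (p : building) : prebuilding :=
  repr (p : {eq_quot bldg_equiv}%qT).

Lemma breprK p : bpt (brepr p).1 (brepr p).2 = p.
Proof. by rewrite /bpt -surjective_pairing; exact: reprK. Qed.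

Lemma bptP g c h d : bpt g c = bpt h d <->
  c = d /\ gp_sub (ones (val c)) (g^-1 * h)%g.
Proof.
split=> [/eqP|gh].
  by rewrite /bpt -[_ == _]/(_ == _ %[mod _])%qT eqmodE => /asboolP.
by apply/eqP; rewrite /bpt -[_ == _]/(_ == _ %[mod _])%qT eqmodE; apply/asboolP.
Qed.

(* The retraction [g, x] |-> x of the building onto C. *)
Definition coord (p : building) : {ffun I -> R} := val (brepr p).2.

Lemma coord_bpt g c : coord (bpt g c) = val c.
Proof.
have /bptP[E _] : bpt (brepr (bpt g c)).1 (brepr (bpt g c)).2 = bpt g c.
  exact: breprK.
by rewrite /coord E.
Qed.

Definition vertex_of_type J (p : building) : Prop :=
  exists g c, val c = vtx J /\ p = bpt g c.

Definition vertex (p : building) : Prop := exists J, vertex_of_type J p.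

Definition cube (A : set building) : Prop :=
  exists g J K, [/\ J \subset K, spherical K &
    A = [set bpt g c | c in [set c | cube_face J K (val c)]]].

(* The Euclidean distance between two points of a common cube. *)
Definition euclid (p q : building) : R :=
  Num.sqrt (\sum_i (coord p i - coord q i) ^+ 2).

(* The length metric is the infimum of the lengths of the piecewise linear
   paths, i.e. of the strings of points in which any two consecutive points
   belong to a common cube. The infimum is over a nonempty set because the
   building is connected: each chamber is star-shaped about its vertex of type
   set0, and chambers g C and g a C with a in some G i share the vertex of type
   [set i]. *)
Fixpoint is_string (p : building) (s : seq building) : Prop :=
  if s is q :: s' then
    (exists A, [/\ cube A, A p & A q]) /\ is_string q s'
  else True.

Fixpoint string_length (p : building) (s : seq building) : R :=
  if s is q :: s' then euclid p q + string_length q s' else 0.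

Definition building_dist (p q : building) : R :=
  inf [set string_length p s | s in [set s | is_string p s /\ last p s = q]].

(** ** Type-preserving automorphisms *)

(* An automorphism of the cube complex is a bijection permuting the cubes and
   isometric on each of them. *)
Definition is_aut0 (f : building -> building) : Prop :=
  [/\ forall A, cube A <-> cube (f @` A),
      forall A p q, cube A -> A p -> A q -> euclid (f p) (f q) = euclid p q &
      forall J p, vertex_of_type J p <-> vertex_of_type J (f p)].

Record aut0 := Aut0 {
  aut0_fun :> building -> building;
  aut0_inv : building -> building;
  aut0_funK : cancel aut0_fun aut0_inv;
  aut0_invK : cancel aut0_inv aut0_fun;
  aut0P : is_aut0 aut0_fun }.

HB.instance Definition _ := gen_eqMixin aut0.
HB.instance Definition _ := gen_choiceMixin aut0.

Lemma aut0_eqP (f g : aut0) : f =1 g -> f = g.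
Proof.
case: f => f f' fK f'K fP; case: g => g g' gK g'K gP /= fg.
have {}fg : f = g by apply/funext.
case: g / fg gK g'K gP => gK g'K gP.
have fg' : f' = g' by apply/funext => p; rewrite -[in LHS](g'K p) fK.
case: g' / fg' gK g'K => gK g'K.
by congr Aut0; exact: Prop_irrelevance.
Qed.

Lemma is_aut0_id : is_aut0 idfun.
Proof. by split=> // A; rewrite (_ : _ @` _ = A) //; exact: image_id. Qed.

Lemma is_aut0_comp f g : is_aut0 f -> is_aut0 g -> is_aut0 (f \o g).
Proof.
move=> [fc fe fv] [gc ge gv]; split=> [A|A p q cA Ap Aq|J p] /=.
- by rewrite -image_comp -fc -gc.
- by rewrite -(ge _ _ _ cA Ap Aq); apply: (fe (g @` A));
    [rewrite -gc|exact: imageP|exact: imageP].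
by rewrite -fv -gv.
Qed.

Lemma is_aut0_inv f g : cancel f g -> cancel g f -> is_aut0 f -> is_aut0 g.
Proof.
move=> fK gK [fc fe fv].
have fgA (A : set building) : f @` (g @` A) = A.
  by rewrite image_comp (_ : f \o g = idfun) ?image_id //; apply/funext => p; exact: gK.
have gc A : cube A <-> cube (g @` A) by rewrite (fc (g @` A)) fgA.
split=> // [A p q cA Ap Aq|J p]; last by rewrite (fv J (g p)) gK.
have := fe (g @` A) (g p) (g q); rewrite !gK => <- //;
  by [rewrite -gc|exact: imageP].
Qed.

Definition aut0_one : aut0 :=
  @Aut0 idfun idfun (fun=> erefl) (fun=> erefl) is_aut0_id.
Definition aut0_mul (f g : aut0) : aut0 :=
  @Aut0 (f \o g) (aut0_inv g \o aut0_inv f)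
    (can_comp (aut0_funK f) (aut0_funK g)) (can_comp (aut0_invK g) (aut0_invK f))
    (is_aut0_comp (aut0P f) (aut0P g)).
Definition aut0_V (f : aut0) : aut0 :=
  @Aut0 (aut0_inv f) f (aut0_invK f) (aut0_funK f)
    (is_aut0_inv (aut0_funK f) (aut0_invK f) (aut0P f)).

Lemma aut0_mulA : associative aut0_mul.
Proof. by move=> f g h; exact: aut0_eqP. Qed.
Lemma aut0_mul1 : left_id aut0_one aut0_mul.
Proof. by move=> f; exact: aut0_eqP. Qed.
Lemma aut0_mulr1 : right_id aut0_one aut0_mul.
Proof. by move=> f; exact: aut0_eqP. Qed.
Lemma aut0_mulV : left_inverse aut0_one aut0_V aut0_mul.
Proof. by move=> f; apply: aut0_eqP => p /=; rewrite aut0_funK. Qed.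
Lemma aut0_mulrV : right_inverse aut0_one aut0_V aut0_mul.
Proof. by move=> f; apply: aut0_eqP => p /=; rewrite aut0_invK. Qed.

HB.instance Definition _ := isGroup.Build aut0
  aut0_mulA aut0_mul1 aut0_mulr1 aut0_mulV aut0_mulrV.

(** ** The action of the graph product *)

Definition lmul_fun (g : graph_product e G) (p : building) : building :=
  bpt (g * (brepr p).1)%g (brepr p).2.

Lemma lmul_bpt g h c : lmul_fun g (bpt h c) = bpt (g * h)%g c.
Proof.
have /bptP[E H] : bpt (brepr (bpt h c)).1 (brepr (bpt h c)).2 = bpt h c.
  exact: breprK.
apply/bptP; split=> //.
by rewrite invgM mulgA mulgKV.
Qed.

Lemma lmulK g : cancel (lmul_fun g) (lmul_fun g^-1%g).
Proof. by move=> p; rewrite -[p]breprK !lmul_bpt mulKg. Qed.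

Lemma lmulVK g : cancel (lmul_fun g^-1%g) (lmul_fun g).
Proof. by move=> p; rewrite -[p]breprK !lmul_bpt mulgA mulgV mul1g. Qed.

Lemma is_aut0_lmul g : is_aut0 (lmul_fun g).
Proof.
have cub h A : cube A -> cube (lmul_fun h @` A).
  move=> [k [J [K [JK sK ->]]]]; exists (h * k)%g, J, K; split=> //.
  rewrite image_comp; apply: eq_imagel => c _ /=.
  by rewrite lmul_bpt.
have vert h J p : vertex_of_type J p -> vertex_of_type J (lmul_fun h p).
  by move=> [k [c [cJ ->]]]; exists (h * k)%g, c; rewrite lmul_bpt.
have coordE p : coord (lmul_fun g p) = coord p.
  by rewrite -[p in LHS]breprK lmul_bpt coord_bpt.
split=> [A|A p q _ _ _|J p].
- split=> [/cub//|/(cub g^-1%g)]; rewrite image_comp.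
  by rewrite (_ : _ \o _ = idfun) ?image_id //; apply/funext => p; exact: lmulK.
- by rewrite /euclid !coordE.
by split=> [/vert//|/(vert g^-1%g)]; rewrite lmulK.
Qed.

Definition lmul (g : graph_product e G) : aut0 :=
  Aut0 (lmulK g) (lmulVK g) (is_aut0_lmul g).

Definition uniform_lattice (H : set aut0) : Prop :=
  [/\ subgroup H,
      forall v, vertex v -> finite_set [set f | H f /\ f v = v] &
      finite_set [set [set f v | f in H] | v in vertex]].

End Building.

Arguments building_dist R {I} e G p q.
Arguments aut0 R {I} e G.
Arguments lmul R {I} e G g.

(** * Gromov hyperbolicity *)

Section Hyperbolic.
Variables (R : realType) (T : Type) (d : T -> T -> R).
Local Open Scope ring_scope.

(* Gromov's definition, which makes sense in any metric space. *)
Definition gromov_product (w x y : T) : R := (d x w + d y w - d x y) / 2.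

Definition gromov_hyperbolic : Prop :=
  exists delta : R, forall w x y z : T,
    Num.min (gromov_product w x y) (gromov_product w y z) - delta
      <= gromov_product w x z.

End Hyperbolic.

(* Main.v *)
(* Chambers (the vertices [g, v_0]) are identified with elements of Gamma, and
   Aut_0 with the bijections of Gamma preserving the panels g G_i.

   In a hyperbolic space a coarsely geodesic subset T has coarse gates, so the
   nearest-point projection to T contracts balls disjoint from T and
   quasi-geodesics with ends near T stay near T (the Morse lemma). Applied to
   T = b Gamma_J this makes the stabilizers of the cosets b Gamma_J in the
   lattice quasiconvex.

   The stabilizer of the i-wall b Gamma_(i, nbr i) permutes its finitely many
   cosets of Gamma_(nbr i), the colours of the wall. The stabilizer of a colour
   is quasiconvex, hence separable; since there are finitely many orbits of
   walls, some finite-index subgroup N of the lattice permutes no colours.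
   Then all walls can be coloured by G_i in an N-invariant way. The colourings
   define a new right action of Gamma on the chambers, simply transitive and
   commuting with N; identifying chambers with Gamma through it conjugates N
   into the group of left multiplications. *)
Require Import Defs.
From mathcomp Require Import all_boot all_order all_fingroup all_algebra.
From mathcomp Require Import boolp classical_sets cardinality reals.
From mathcomp Require Import lra zify.
(* Again, since fingroup redefines [generated]. *)
Require Import Defs.
Set Implicit Arguments.
Unset Strict Implicit.
Unset Printing Implicit Defensive.
Import Order.TTheory GRing.Theory Num.Theory.
Local Open Scope classical_set_scope.

(** * Finite-index subgroups *)

Section FiniteIndex.
Variable G : groupType.
Implicit Types (H K L : set G).

Lemma subgroup_mulVg H x y : subgroup H -> H x -> H y -> H (x^-1 * y)%g.
Proof. by move=> [_ HM HV] Hx Hy; apply: HM => //; exact: HV. Qed.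

Lemma subgroup_trans H x y z :
  subgroup H -> H (x^-1 * y)%g -> H (y^-1 * z)%g -> H (x^-1 * z)%g.
Proof. by move=> [_ HM _] xy yz; have := HM _ _ xy yz; rewrite mulgA mulgK. Qed.

Lemma subgroup_sym H x y : subgroup H -> H (x^-1 * y)%g -> H (y^-1 * x)%g.
Proof. by move=> [_ _ HV] /HV; rewrite invgM invgK. Qed.

Lemma subgroup_generated (S K : set G) : subgroup K -> S `<=` K -> generated S `<=` K.
Proof. by move=> sK SK x; apply. Qed.

Lemma sub_generated (S : set G) : S `<=` generated S.
Proof. by move=> x Sx K [_]; apply. Qed.

Lemma subgroupI H K : subgroup H -> subgroup K -> subgroup (H `&` K).
Proof.
move=> [H1 HM HV] [K1 KM KV]; split=> // [x y [? ?] [? ?]|x [? ?]]; split;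
by [exact: HM|exact: KM|exact: HV|exact: KV].
Qed.

(** A finite-valued map that separates the left cosets of [H] in [K] but may vary within a coset.
    Finite index in this form is easy to combine and to transport. *)
Definition coset_coloring (T : finType) (f : G -> T) H K : Prop :=
  forall x y, K x -> K y -> f x = f y -> H (x^-1 * y)%g.

Lemma finite_index_color H K : subgroup H -> finite_index H K ->
  exists (T : finType) (f : G -> T), coset_coloring f H K.
Proof.
move=> [H1 _ _] [_ /finite_seqP[s sE]].
(* The colour of [x] is the position of its coset in the enumeration [s]; the successor makes the
   ordinal type inhabited, as [inord] requires. *)
exists 'I_(size s).+1, (fun x => inord (index [set x * h | h in H]%g s)) => x y Kx Ky xy.
have lti z : K z -> (index [set z * h | h in H]%g s < size s)%N.
  move=> Kz; rewrite index_mem.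
  have : [set` s] [set z * h | h in H]%g by rewrite -sE; exists z.
  by [].
have : index [set x * h | h in H]%g s = index [set y * h | h in H]%g s.
  by move/(congr1 val): xy; rewrite /= !inordK// ltnS ltnW// lti.
move=> /(congr1 (nth set0 s)); rewrite !nth_index -?index_mem ?lti// => E.
have : [set x * h | h in H]%g y by rewrite E; exists 1%g; rewrite ?mulg1.
by case=> h Hh <-; rewrite mulKg.
Qed.

Lemma color_finite_index (T : finType) (f : G -> T) H K :
  subgroup H -> H `<=` K -> coset_coloring f H K -> finite_index H K.
Proof.
move=> sH HK fP; split=> //; have [_ HM _] := sH.
(* The default 1, taken for colours that do not occur, adds at most one coset to the finite list. *)
pose r (t : T) := xget 1%g [set x | K x /\ f x = t].
apply: (@sub_finite_set _ _ [set [set r t * h | h in H]%g | t in [set: T]]); last first.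
  by apply: finite_image; exact: finite_finset.
move=> _ [x Kx <-]; exists (f x) => //.
have [Kr rE] : K (r (f x)) /\ f (r (f x)) = f x.
  by apply: (@xgetPex _ 1%g [set y | K y /\ f y = f x]); exists x.
have xr := fP _ _ Kx Kr (esym rE); have rx := fP _ _ Kr Kx rE.
apply/seteqP; split=> _ [h Hh <-].
  by exists (x^-1 * r (f x) * h)%g; [exact: HM|rewrite -mulgA mulKVg].
by exists ((r (f x))^-1 * x * h)%g; [exact: HM|rewrite -mulgA mulKVg].
Qed.

Lemma coset_coloringI (T U : finType) (f : G -> T) (g : G -> U) H K L :
  coset_coloring f H L -> coset_coloring g K L ->
  coset_coloring (fun x => (f x, g x)) (H `&` K) L.
Proof. by move=> fP gP x y Lx Ly [] /(fP _ _ Lx Ly) ? /(gP _ _ Lx Ly) ?. Qed.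

Lemma finite_indexI H K L : subgroup H -> subgroup K ->
  finite_index H L -> finite_index K L -> finite_index (H `&` K) L.
Proof.
move=> sH sK fH fK; have [T [f fP]] := finite_index_color sH fH.
have [U [g gP]] := finite_index_color sK fK.
apply: (@color_finite_index _ (fun x => (f x, g x))); first exact: subgroupI.
  by move=> x [Hx _]; case: fH => + _; apply.
exact: coset_coloringI.
Qed.

Lemma finite_index_refl H : subgroup H -> finite_index H H.
Proof.
move=> sH; apply: (@color_finite_index _ (fun=> tt)) => // x y Hx Hy _.
exact: subgroup_mulVg.
Qed.

Lemma finite_index_sub H K L : subgroup H -> subgroup K ->
  H `<=` K -> K `<=` L -> finite_index H L -> finite_index K L.
Proof.
move=> sH sK HK KL /(finite_index_color sH)[T [f fP]].
apply: (color_finite_index sK KL (f := f)) => x y Lx Ly xy.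
by apply: HK; exact: fP.
Qed.

Definition normalized_by (N H : set G) : Prop :=
  forall x y, N x -> H y -> N (y^-1 * x * y)%g.

(** [N] is the normal core of [K]. An element of [H] is coloured by how it moves representatives of
    the cosets of [K]; if [x] and [y] move them into the same cosets, all [H]-conjugates of x^-1 y
    lie in [K]. *)
Lemma finite_index_core H K : subgroup H -> subgroup K -> finite_index K H ->
  exists N, [/\ subgroup N, N `<=` K, finite_index N H & normalized_by N H].
Proof.
move=> sH sK KH; have [T [f fP]] := finite_index_color sK KH.
have [H1 HM HV] := sH; have [K1 KM KV] := sK.
pose N := [set x | H x /\ forall y, H y -> K (y^-1 * x * y)%g].
have sN : subgroup N.
  split=> [|x y [Hx xP] [Hy yP]|x [Hx xP]].
  - by split=> // y Hy; rewrite mulg1 mulVg.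
  - split=> [|z Hz]; first exact: HM.
    by have := KM _ _ (xP _ Hz) (yP _ Hz); rewrite !mulgA mulgK.
  split=> [|z Hz]; first exact: HV.
  by have := KV _ (xP _ Hz); rewrite !invgM invgK mulgA.
pose r (t : T) := xget 1%g [set x | H x /\ f x = t].
have rP x : H x -> H (r (f x)) /\ f (r (f x)) = f x.
  by move=> Hx; apply: (@xgetPex _ 1%g [set y | H y /\ f y = f x]); exists x.
exists N; split=> //.
- by move=> x [_ /(_ _ H1)]; rewrite invg1 mul1g mulg1.
- apply: (@color_finite_index {ffun T -> T} (fun x => [ffun t => f (x * r t)%g])) => //.
    by move=> x [].
  move=> x y Hx Hy /ffunP E; split=> [|z Hz]; first exact: subgroup_mulVg.
  have [Hr rE] := rP _ Hz.
  have zr : K (z^-1 * r (f z))%g by apply: fP.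
  have /fP : f (x * r (f z))%g = f (y * r (f z))%g by have := E (f z); rewrite !ffunE.
  move=> /(_ (HM _ _ Hx Hr) (HM _ _ Hy Hr)) xy.
  have := KM _ _ (KM _ _ zr xy) (KV _ zr).
  by rewrite !invgM !invgK !mulgA !mulgK.
move=> x y [Hx xP] Hy; split=> [|z Hz].
  by apply: (HM) => //; apply: HM => //; exact: HV.
by have := xP _ (HM _ _ Hy Hz); rewrite !invgM !mulgA.
Qed.

(** Each element of [s] outside [L] is excluded by some finite-index subgroup containing [L], and
    finitely many of these are intersected. *)
Lemma separable_avoid (H L : set G) (s : seq G) :
  subgroup H -> subgroup L -> L `<=` H -> separable_in H L ->
  exists N, [/\ subgroup N, finite_index N H, L `<=` N & forall x, x \in s -> N x -> L x].
Proof.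
move=> sH sL LH sep; elim: s => [|x s [N [sN fN LN NP]]].
  by exists H; split=> //; exact: finite_index_refl.
have [Lx|nLx] := pselect (L x).
  by exists N; split=> // y; rewrite inE => /orP[/eqP->//|]; exact: NP.
have [K [sK fK LK nKx]] : exists K, [/\ subgroup K, finite_index K H, L `<=` K & ~ K x].
  apply: contrapT => nK; apply: nLx; rewrite sep => K [sK fK LK].
  by apply: contrapT => nKx; apply: nK; exists K.
exists (N `&` K); split; [exact: subgroupI|exact: finite_indexI| |].
  by move=> y Ly; split; [exact: LN|exact: LK].
by move=> y; rewrite inE => /orP[/eqP-> []//|/NP yP [/yP]].
Qed.

(* Separability of [L] promotes the finite index of [L] in [St] to a normal
   finite-index subgroup of [H] meeting [St] inside [L]. *)
Lemma separable_normal (T : finType) (f : G -> T) (H St L : set G) :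
  subgroup H -> subgroup L -> L `<=` H -> separable_in H L -> coset_coloring f L St ->
  exists N, [/\ subgroup N, finite_index N H, normalized_by N H & N `&` St `<=` L].
Proof.
move=> sH sL LH sep fP.
(* One element of [St] outside [L] for each colour. Avoiding these suffices: an element of [St] and
   the representative of its colour differ by an element of [L], which lies in [M]. *)
pose r (t : T) := xget 1%g [set x | [/\ St x, f x = t & ~ L x]].
have [M [sM fM LM MP]] := separable_avoid [seq r t | t : T] sH sL LH sep.
have [N [sN NM fN nN]] := finite_index_core sH sM fM.
exists N; split=> // x [/NM Mx Sx]; apply: contrapT => nLx.
have [Sr rE nLr] : [/\ St (r (f x)), f (r (f x)) = f x & ~ L (r (f x))].
  by apply: (@xgetPex _ 1%g [set y | [/\ St y, f y = f x & ~ L y]]); exists x.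
apply: nLr; apply: MP; first by apply/mapP; exists (f x); rewrite ?mem_enum.
have [_ MM MV] := sM; have := LM _ (fP _ _ Sx Sr (esym rE)) => /(MM _ _ Mx).
by rewrite mulKVg.
Qed.

Lemma conj_setP (g : G) (H : set G) x : conj_set g H x <-> H (g^-1 * x * g)%g.
Proof.
split=> [[h Hh <-]|Hx]; first by rewrite !mulgA mulVg mul1g mulgKV.
by exists (g^-1 * x * g)%g; rewrite // !mulgA mulgV mul1g mulgK.
Qed.

Lemma subgroup_conj (g : G) (H : set G) : subgroup H -> subgroup (conj_set g H).
Proof.
move=> [H1 HM HV]; split=> [|x y /conj_setP Hx /conj_setP Hy|x /conj_setP Hx];
  apply/conj_setP.
- by rewrite mulg1 mulVg.
- by have := HM _ _ Hx Hy; rewrite !mulgA mulgK.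
by have := HV _ Hx; rewrite !invgM invgK mulgA.
Qed.

Lemma finite_index_conj (g : G) (H K : set G) : subgroup H ->
  finite_index H K -> finite_index (conj_set g H) (conj_set g K).
Proof.
move=> sH fH; have [T [f fP]] := finite_index_color sH fH.
apply: (@color_finite_index _ (fun x => f (g^-1 * x * g)%g)).
- exact: subgroup_conj.
- by move=> x /conj_setP Hx; apply/conj_setP; case: fH => + _; apply.
move=> x y /conj_setP Kx /conj_setP Ky /(fP _ _ Kx Ky) Hxy; apply/conj_setP.
by move: Hxy; rewrite !invgM invgK !mulgA mulgK.
Qed.

End FiniteIndex.

(** * Graph products *)

Section GraphProductAction.
Variables (I : finType) (e : rel I) (G : I -> finGroupType) (X : Type).
Variable act : forall i, X -> G i -> X.
Hypothesis act1 : forall i x, act x (1%g : G i) = x.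
Hypothesis actM : forall i x (g h : G i), act x (g * h)%g = act (act x g) h.
Hypothesis actC : forall i j x (g : G i) (h : G j),
  i <> j -> e i j -> act (act x g) h = act (act x h) g.

Definition word_act (x : X) (w : seq (letter G)) : X :=
  foldl (fun y a => act y (tagged a)) x w.

Lemma word_act_cat x u v : word_act x (u ++ v) = word_act (word_act x u) v.
Proof. exact: foldl_cat. Qed.

Lemma word_act_fp u v : fp_eq u v -> forall x, word_act x u = word_act x v.
Proof.
elim=> {u v} [|u v _ IH x|u v w _ IH _ IH' x|u u' v v' _ IH _ IH' x|i x|i g h x] //.
- by rewrite IH.
- by rewrite !word_act_cat IH.
- exact: act1.
by rewrite /= actM.
Qed.

Definition fp_act (x : X) (a : free_product G) : X := word_act x (fp_repr a).

Lemma fp_actE x w : fp_act x (fp_proj w) = word_act x w.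
Proof. exact/word_act_fp/FpSym/fp_reprP. Qed.

Lemma fp_actM x a b : fp_act x (a * b)%g = fp_act (fp_act x a) b.
Proof.
rewrite -[a]fp_reprK -[b]fp_reprK.
by rewrite -[(_ * _)%g]/(fp_mul _ _) -fp_projM !fp_actE word_act_cat.
Qed.

Lemma fp_act1 x : fp_act x 1%g = x.
Proof. by rewrite -[1%g]/(fp_proj [::]) fp_actE. Qed.

Lemma fp_actKV a x : fp_act (fp_act x a) a^-1%g = x.
Proof. by rewrite -fp_actM mulgV fp_act1. Qed.

(** The elements acting trivially form a normal subgroup, which contains the relators by [actC]. *)
Lemma fp_act_ncl a : normal_closure (gp_relators e (G := G)) a -> forall x, fp_act x a = x.
Proof.
move=> /(_ [set a | forall x, fp_act x a = x]); apply; split; first split.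
- split=> [x|a' b' Ha Hb x|a' Ha x] /=; first exact: fp_act1.
    by rewrite fp_actM Ha Hb.
  by rewrite -{1}(Ha x) fp_actKV.
- by move=> a' b' Ha x /=; rewrite !fp_actM Ha -{2}[b']invgK fp_actKV.
move=> _ [i [j [g [h [ij eij ->]]]]] x /=.
have E : fp_act (fp_act x (fp_inj g)) (fp_inj h) = fp_act (fp_act x (fp_inj h)) (fp_inj g).
  by rewrite !fp_actE /= actC.
by rewrite !fp_actM E !fp_actKV.
Qed.

(** The universal property of the graph product: right actions of the [G i] that commute for
    adjacent indices extend to Gamma. Maps out of Gamma are defined below as orbit maps of such
    actions. *)
Definition gp_act (x : X) (g : graph_product e G) : X := fp_act x (ncl_repr g).

Lemma gp_actE x a : gp_act x (ncl_proj _ a) = fp_act x a.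
Proof.
rewrite /gp_act -[RHS](fp_act_ncl (ncl_reprP (S := gp_relators e (G := G)) a)).
by rewrite -fp_actM mulKVg.
Qed.

Lemma gp_actM x g h : gp_act x (g * h)%g = gp_act (gp_act x g) h.
Proof.
rewrite -[g]ncl_reprK -[h]ncl_reprK.
by rewrite -[(_ * _)%g]/(ncl_mul _ _) -ncl_projM !gp_actE fp_actM.
Qed.

Lemma gp_act1 x : gp_act x 1%g = x.
Proof. by rewrite -[1%g]/(ncl_proj _ 1%g) gp_actE fp_act1. Qed.

Lemma gp_act_inj i x (g : G i) : gp_act x (gp_inj e g) = act x g.
Proof. by rewrite gp_actE fp_actE. Qed.

End GraphProductAction.

(** * Words, the subgroups Gamma_J, their retractions, and the word metric *)

Section GraphProductTheory.
Variables (I : finType) (e : rel I) (G : I -> finGroupType).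
Local Notation Gam := (graph_product e G).
Implicit Types (g h : Gam) (w : seq (letter G)) (J K : {set I}).

Definition gp_word w : Gam := ncl_proj (gp_relators e (G := G)) (fp_proj w).

Lemma gp_word_nil : gp_word [::] = 1%g.
Proof. by []. Qed.

Lemma gp_word_cat u v : gp_word (u ++ v) = (gp_word u * gp_word v)%g.
Proof. by rewrite /gp_word fp_projM; exact: ncl_projM. Qed.

Lemma gp_word1 (a : letter G) : gp_word [:: a] = gp_inj e (tagged a).
Proof. by case: a. Qed.

Lemma gp_word_rcons w (a : letter G) : gp_word (rcons w a) = (gp_word w * gp_inj e (tagged a))%g.
Proof. by rewrite -cats1 gp_word_cat gp_word1. Qed.

Lemma gp_word_cons w (a : letter G) : gp_word (a :: w) = (gp_inj e (tagged a) * gp_word w)%g.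
Proof. by rewrite -cat1s gp_word_cat gp_word1. Qed.

Lemma gp_wordP g : exists w, g = gp_word w.
Proof. by exists (fp_repr (ncl_repr g)); rewrite /gp_word fp_reprK ncl_reprK. Qed.

Lemma gp_wordV w : gp_word (word_inv w) = (gp_word w)^-1%g.
Proof. by rewrite /gp_word fp_projV; exact: ncl_projV. Qed.

Lemma gp_injM i (a b : G i) : gp_inj e (a * b)%g = (gp_inj e a * gp_inj e b)%g.
Proof.
rewrite /gp_inj -[(_ * _)%g in RHS]/(ncl_mul _ _) -ncl_projM; congr ncl_proj.
rewrite /fp_inj -[(_ * _)%g in RHS]/(fp_mul _ _) -fp_projM; apply/fp_projP/FpSym.
exact: FpMul.
Qed.

Lemma gp_inj1 i : gp_inj e (1%g : G i) = 1%g.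
Proof. by apply: (mulgI (gp_inj e (1%g : G i))); rewrite -gp_injM !mulg1. Qed.

Lemma gp_injV i (a : G i) : gp_inj e a^-1%g = (gp_inj e a)^-1%g.
Proof. by apply: (mulgI (gp_inj e a)); rewrite -gp_injM !mulgV gp_inj1. Qed.

Lemma gp_injC i j (a : G i) (b : G j) : i <> j -> e i j ->
  (gp_inj e a * gp_inj e b = gp_inj e b * gp_inj e a)%g.
Proof.
move=> ij eij; apply: esym; rewrite /gp_inj -![(_ * _)%g]/(ncl_mul _ _) -!ncl_projM.
apply/ncl_projP.
have [[_ _ nclV] nclJ] := normal_closure_normal (gp_relators e (G := G)).
have := nclJ _ (fp_inj a * fp_inj b)%g _.
move=> /(_ (fp_inj a * fp_inj b * (fp_inj a)^-1 * (fp_inj b)^-1)%g) H.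
have -> : ((fp_inj b * fp_inj a)^-1 * (fp_inj a * fp_inj b) =
  (fp_inj a * fp_inj b)^-1 * (fp_inj a * fp_inj b * (fp_inj a)^-1 * (fp_inj b)^-1)
   * (fp_inj a * fp_inj b))%g.
  by rewrite !invgM -!mulgA !mulKg.
by apply: H => H [_]; apply; exists i, j, a, b.
Qed.

Lemma gp_ind (P : Gam -> Prop) : P 1%g ->
  (forall g i (a : G i), P g -> P (g * gp_inj e a)%g) -> forall g, P g.
Proof.
move=> P1 PM g; have [w ->] := gp_wordP g.
elim/last_ind: w => // w a IH; rewrite gp_word_rcons; exact: PM.
Qed.

Lemma subgroup_gp_sub J : subgroup (gp_sub (e := e) (G := G) J).
Proof. exact: generated_subgroup. Qed.

Lemma gp_sub1 J : gp_sub J (1%g : Gam).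
Proof. by case: (subgroup_gp_sub J). Qed.

Lemma gp_subM J g h : gp_sub J g -> gp_sub J h -> gp_sub J (g * h)%g.
Proof. by case: (subgroup_gp_sub J) => _ + _; apply. Qed.

Lemma gp_sub_inj J j (a : G j) : j \in J -> gp_sub J (gp_inj e a).
Proof. by move=> jJ; apply: sub_generated; exists j => //; exists a. Qed.

Lemma gp_subM_inj J g j (a : G j) : gp_sub J g -> j \in J -> gp_sub J (g * gp_inj e a)%g.
Proof. by move=> gJ jJ; apply: gp_subM => //; exact: gp_sub_inj. Qed.

Lemma gp_sub_word J g : gp_sub J g <-> exists2 w, all (fun a => tag a \in J) w & g = gp_word w.
Proof.
split=> [|[w wJ ->]]; last first.
  elim: w wJ => [_|a w IH /= /andP[aJ /IH]]; first exact: gp_sub1.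
  by rewrite gp_word_cons; apply: gp_subM; exact: gp_sub_inj.
pose K := [set h : Gam | exists2 w, all (fun a => tag a \in J) w & h = gp_word w].
apply: (@subgroup_generated _ _ K); first split.
- by exists [::].
- by move=> _ _ [u uJ ->] [v vJ ->]; exists (u ++ v); rewrite ?all_cat ?uJ ?gp_word_cat.
- move=> _ [u uJ ->]; exists (word_inv u); last by rewrite gp_wordV.
  by rewrite all_rev all_map.
by move=> _ [j jJ [a ->]]; exists [:: lett a]; rewrite /= ?jJ.
Qed.

Lemma gp_sub_ind J (P : Gam -> Prop) : P 1%g ->
  (forall g i (a : G i), i \in J -> P g -> P (g * gp_inj e a)%g) -> forall g, gp_sub J g -> P g.
Proof.
move=> P1 PM _ /gp_sub_word[w + ->].
elim/last_ind: w => // w a IH; rewrite all_rcons gp_word_rcons => /andP[aJ /IH].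
exact: PM.
Qed.

Lemma gp_subS J K : J \subset K -> gp_sub J `<=` gp_sub (e := e) (G := G) K.
Proof.
move=> /fintype.subsetP JK; apply: (@gp_sub_ind _ (gp_sub K)) => [|g i a iJ gK].
  exact: gp_sub1.
by apply: gp_subM_inj => //; exact: JK.
Qed.

Lemma gp_sub_set1 i g : gp_sub [set i]%SET g -> exists a : G i, g = gp_inj e a.
Proof.
apply: (@gp_sub_ind _ (fun g => exists a : G i, g = gp_inj e a)).
  by exists 1%g; rewrite gp_inj1.
by move=> _ j b /set1P ji [a ->]; subst j; exists (a * b)%g; rewrite gp_injM.
Qed.

Lemma gp_sub0 g : gp_sub finset.set0 g -> g = 1%g.
Proof.
by apply: (@gp_sub_ind _ (fun g => g = 1%g)) => // h i a; rewrite finset.in_set0.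
Qed.

(** [G i] commutes with Gamma_K, so a new letter from [K] can be moved to the left of the
    [G i]-part. *)
Lemma gp_sub_cone i K g : (forall k, k \in K -> i != k /\ e i k) -> gp_sub (i |: K) g ->
  exists h (a : G i), gp_sub K h /\ g = (h * gp_inj e a)%g.
Proof.
move=> iK.
apply: (@gp_sub_ind _ (fun g => exists h (a : G i), gp_sub K h /\ g = (h * gp_inj e a)%g)).
  by exists 1%g, 1%g; rewrite gp_inj1 mulg1; split=> //; exact: gp_sub1.
move=> _ j b jK [h [a [hK ->]]]; case/setU1P: jK => [ji|jK].
  by subst j; exists h, (a * b)%g; rewrite gp_injM mulgA.
exists (h * gp_inj e b)%g, a; split; first exact: gp_subM_inj.
by rewrite -!mulgA gp_injC //; case: (iK _ jK) => // /eqP.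
Qed.

Section Retraction.
Variable J : {set I}.

Definition retr_act i g (a : G i) : Gam := if i \in J then (g * gp_inj e a)%g else g.

(** The homomorphism Gamma -> Gamma_J killing the other factors, as the orbit map of 1 under an
    action in which those factors act trivially. *)
Definition gp_retr g : Gam := gp_act retr_act 1%g g.

Lemma retr_act1 i g : retr_act g (1%g : G i) = g.
Proof. by rewrite /retr_act gp_inj1 mulg1 if_same. Qed.

Lemma retr_actM i g (a b : G i) : retr_act g (a * b)%g = retr_act (retr_act g a) b.
Proof. by rewrite /retr_act; case: ifP => // _; rewrite gp_injM mulgA. Qed.

Lemma retr_actC i j g (a : G i) (b : G j) : i <> j -> e i j ->
  retr_act (retr_act g a) b = retr_act (retr_act g b) a.
Proof.
move=> ij eij; rewrite /retr_act; case: ifP; case: ifP => // _ _.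
by rewrite -!mulgA gp_injC.
Qed.

Let actM := gp_actM retr_act1 retr_actM retr_actC.
Let act1 := gp_act1 retr_act1 retr_actM retr_actC.
Let act_inj := gp_act_inj retr_act1 retr_actM retr_actC.

Lemma gp_retr1 : gp_retr 1 = 1%g.
Proof. exact: act1. Qed.

Lemma gp_retr_inj g i (a : G i) :
  gp_retr (g * gp_inj e a)%g = if i \in J then (gp_retr g * gp_inj e a)%g else gp_retr g.
Proof. by rewrite /gp_retr actM act_inj. Qed.

Lemma gp_retr_sub g : gp_sub J (gp_retr g).
Proof.
elim/gp_ind: g => [|g i a IH]; first by rewrite gp_retr1; exact: gp_sub1.
by rewrite gp_retr_inj; case: ifP => // iJ; exact: gp_subM_inj.
Qed.

Lemma gp_retr_id g : gp_sub J g -> gp_retr g = g.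
Proof.
apply: (@gp_sub_ind _ (fun g => gp_retr g = g)); first exact: gp_retr1.
by move=> h i a iJ IH; rewrite gp_retr_inj iJ IH.
Qed.

End Retraction.

Section Coordinate.
Variable i : I.

(** [tagged_as] reads [a] as an element of [G i] when [j] is [i] and falls back on 1 otherwise; the
    orbit map [gp_coord] is thus the projection of Gamma onto [G i]. *)
Definition coord_act j (c : G i) (a : G j) : G i := (c * tagged_as (lett (1%g : G i)) (lett a))%g.

Definition gp_coord g : G i := gp_act coord_act 1%g g.

Lemma lett_as_id (a : G i) : tagged_as (lett (1%g : G i)) (lett a) = a.
Proof. exact: tagged_asE. Qed.

Lemma lett_as_neq j (a : G j) : i <> j -> tagged_as (lett (1%g : G i)) (lett a) = 1%g.
Proof. by rewrite /tagged_as /=; case: eqP. Qed.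

Lemma coord_act_id c (a : G i) : coord_act c a = (c * a)%g.
Proof. by rewrite /coord_act lett_as_id. Qed.

Lemma coord_act_neq j c (a : G j) : i <> j -> coord_act c a = c.
Proof. by move=> ij; rewrite /coord_act lett_as_neq // mulg1. Qed.

Lemma coord_act1 j c : coord_act c (1%g : G j) = c.
Proof.
have [ij|/eqP/coord_act_neq//] := eqVneq i j.
by subst j; rewrite coord_act_id mulg1.
Qed.

Lemma coord_actM j c (a b : G j) : coord_act c (a * b)%g = coord_act (coord_act c a) b.
Proof.
have [ij|/eqP ij] := eqVneq i j; last by rewrite !coord_act_neq.
by subst j; rewrite !coord_act_id mulgA.
Qed.

Lemma coord_actC j k c (a : G j) (b : G k) : j <> k -> e j k ->
  coord_act (coord_act c a) b = coord_act (coord_act c b) a.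
Proof.
have [ij jk _|/eqP ij jk _] := eqVneq i j; last by rewrite !(coord_act_neq _ _ ij).
by rewrite !(@coord_act_neq k) // => ik; apply: jk; rewrite -ij.
Qed.

Let actM := gp_actM coord_act1 coord_actM coord_actC.
Let act1 := gp_act1 coord_act1 coord_actM coord_actC.
Let act_inj := gp_act_inj coord_act1 coord_actM coord_actC.

Lemma gp_coord1 : gp_coord 1 = 1%g.
Proof. exact: act1. Qed.

Lemma gp_coord_inj g (a : G i) : gp_coord (g * gp_inj e a)%g = (gp_coord g * a)%g.
Proof. by rewrite /gp_coord actM act_inj coord_act_id. Qed.

Lemma gp_coord_neq g j (a : G j) : i <> j -> gp_coord (g * gp_inj e a)%g = gp_coord g.
Proof. by move=> ij; rewrite /gp_coord actM act_inj coord_act_neq. Qed.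

Lemma gp_coord_sub K g h : i \notin K -> gp_sub K h -> gp_coord (g * h)%g = gp_coord g.
Proof.
move=> iK; apply: (@gp_sub_ind _ (fun h => gp_coord (g * h)%g = gp_coord g)).
  by rewrite mulg1.
move=> {}h j a jK IH; rewrite mulgA gp_coord_neq // => ij.
by rewrite ij jK in iK.
Qed.

End Coordinate.

(** Distance at most [n] in the left-invariant word metric whose generators are all elements of all
    [G i]. *)
Definition near n g h := exists2 w, (size w <= n)%N & h = (g * gp_word w)%g.

Lemma near_refl g : near 0 g g.
Proof. by exists [::]; rewrite // gp_word_nil mulg1. Qed.

Lemma nearW m n g h : (m <= n)%N -> near m g h -> near n g h.
Proof. by move=> mn [w wm ->]; exists w => //; exact: leq_trans mn. Qed.

Lemma near_trans m n g h k : near m g h -> near n h k -> near (m + n) g k.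
Proof.
move=> [u um ->] [v vn ->]; exists (u ++ v); last by rewrite gp_word_cat mulgA.
by rewrite size_cat leq_add.
Qed.

Lemma near_sym n g h : near n g h -> near n h g.
Proof.
move=> [w wn ->]; exists (word_inv w); last by rewrite gp_wordV mulgK.
by rewrite size_rev size_map.
Qed.

Lemma near_ex g h : exists n, near n g h.
Proof.
have [w E] := gp_wordP (g^-1 * h)%g; exists (size w), w => //.
by rewrite -E mulKVg.
Qed.

Lemma near_mulg n k g h : near n g h -> near n (k * g)%g (k * h)%g.
Proof. by move=> [w wn ->]; exists w; rewrite ?mulgA. Qed.

Lemma near_finite n g : finite_set [set h | near n g h].
Proof.
apply: (@sub_finite_set _ _ [set (g * gp_word (w : n.-bseq (letter G)))%g |
   w in [set: n.-bseq (letter G)]]).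
  by move=> _ [w wn ->]; exists (Bseq wn).
by apply: finite_image; exact: finite_finset.
Qed.

(** Gamma_J is then a commuting product of the [G j], so one letter per element of [J] suffices;
    [gp_sub_cone] splits off one factor at a time. *)
Lemma spherical_near J g : spherical e J -> gp_sub J g -> near #|J| 1%g g.
Proof.
have [n] := ubnP #|J|; elim: n J g => // n IH J g Jn sJ.
have [->|[i iJ]] := set_0Vmem J; first by move=> /gp_sub0 ->; rewrite cards0; exact: near_refl.
move=> gJ; have : gp_sub (i |: J :\ i)%SET g by rewrite finset.setD1K.
move=> /gp_sub_cone[k|h [a [hJ ->]]].
  by rewrite !inE => /andP[ki kJ]; rewrite eq_sym ki; split=> //; apply: sJ; rewrite // eq_sym.
have iN : #|J| = #|(J :\ i)%SET|.+1 by rewrite (cardsD1 i J) iJ.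
have hN : near #|(J :\ i)%SET| 1 h.
  apply: IH => //; first by rewrite iN ltnS in Jn.
  by move=> k l /setD1P[_ kJ] /setD1P[_ lJ]; exact: sJ.
rewrite iN -addn1; apply: near_trans hN _.
by exists [:: lett a]; rewrite ?gp_word1.
Qed.

End GraphProductTheory.

Arguments subgroup_gp_sub {I e G} J.

(** * Automorphisms of the building *)

Section Chambers.
Variables (R : realType) (I : finType) (e : rel I) (G : I -> finGroupType).
Local Notation Gam := (graph_product e G).
Local Notation chamber := (chamber R e).
Local Notation building := (building R e G).
Local Notation aut0 := (aut0 R e G).
Local Notation vtx := (@vtx R I).
Implicit Types (g h : Gam) (c d : chamber) (p q : building) (f : aut0) (J K : {set I}).
Local Open Scope ring_scope.

Lemma vtx_face J : cube_face finset.set0 J (vtx J).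
Proof.
move=> i; rewrite ffunE; split=> [||/negPf->//]; last by rewrite finset.in_set0.
by case: (i \in J); rewrite /= ?lexx ?ler01.
Qed.

Lemma vtx_in_chamber J : spherical e J -> in_chamber e (vtx J).
Proof. by move=> sJ; exists J => //; exact: vtx_face. Qed.

Definition vertex_chamber J (sJ : spherical e J) : chamber :=
  exist _ (vtx J) (asboolT (vtx_in_chamber sJ)).

Lemma spherical0 : spherical e finset.set0.
Proof. by move=> i j; rewrite finset.in_set0. Qed.

Lemma spherical1 i : spherical e [set i]%SET.
Proof. by move=> j k /set1P-> /set1P->; rewrite eqxx. Qed.

Definition center : chamber := vertex_chamber spherical0.
Definition panel i : chamber := vertex_chamber (@spherical1 i).

Lemma ones_vtx J : ones (vtx J) = J.
Proof.
apply/setP => i; rewrite inE ffunE; case: (i \in J); rewrite /= ?eqxx //.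
by rewrite eq_sym oner_eq0.
Qed.

Definition base g : building := bpt g center.

Lemma base_inj : injective base.
Proof.
move=> g h /bptP[_]; rewrite ones_vtx => /gp_sub0 gh.
by rewrite -[h](mulKVg g) gh mulg1.
Qed.

Lemma vertex0P p : vertex_of_type finset.set0 p <-> exists g, p = base g.
Proof.
split=> [[g [c [cE ->]]]|[g ->]]; last by exists g, center.
by exists g; congr bpt; exact: val_inj.
Qed.

Lemma euclid_bpt g c h d :
  euclid (bpt g c) (bpt h d) = Num.sqrt (\sum_i (val c i - val d i) ^+ 2).
Proof. by rewrite /euclid !coord_bpt. Qed.

Lemma cube_bpt g K c : spherical e K -> cube_face finset.set0 K (val c) ->
  exists A, [/\ cube A, A (base g), A (bpt g c) &
    forall i, i \in K -> A (bpt g (panel i))].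
Proof.
move=> sK cK; exists [set bpt g d | d in [set d | cube_face finset.set0 K (val d)]]; split.
- by exists g, finset.set0, K; split; rewrite ?finset.sub0set.
- exists center => //= i; rewrite ffunE finset.in_set0 /=.
  by rewrite lexx ler01.
- by exists c.
move=> i iK; exists (panel i) => //= j; have [b _ jK] := @vtx_face [set i]%SET j.
by split=> // [|jK']; [rewrite finset.in_set0|apply: jK; apply: contra jK' => /set1P->].
Qed.

Lemma bpt_center g h c : base g = bpt h c -> g = h.
Proof. by move=> E; apply: base_inj; rewrite E; case/bptP: E => <-. Qed.

Lemma cube_base A g p : cube A -> A (base g) -> A p -> exists c, p = bpt g c.
Proof.
by move=> [h [J [K [_ _ ->]]]] [d _ /esym/bpt_center->] [c _ <-]; exists c.
Qed.

(** The action on chambers. Any representative yields the same group element, because the subgroup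
    attached to type [set0] is trivial. *)
Definition hat f g : Gam := (brepr (f (base g))).1.

Lemma hatE f g : f (base g) = base (hat f g).
Proof.
have [_ _ fv] := aut0P f.
have /fv/vertex0P[h E] : vertex_of_type finset.set0 (base g) by apply/vertex0P; exists g.
by rewrite /hat E; congr base; apply: (@bpt_center _ _ (brepr (base h)).2); rewrite breprK.
Qed.

(** Compared with [sum_sqr_vtx0], this recovers [x i] from the distances to the vertices of types
    [set0] and [[set i]]. *)
Lemma sum_sqr_vtx1 (x : {ffun I -> R}) i :
  \sum_j (x j - vtx [set i]%SET j) ^+ 2 = \sum_j x j ^+ 2 - 2 * x i + 1.
Proof.
rewrite (bigD1 i) //= [in RHS](bigD1 i) //= (eq_bigr (fun j => x j ^+ 2)) => [|j ji].
  by rewrite ffunE set11 /=; lra.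
by rewrite ffunE finset.in_set1 (negPf ji) /= subr0.
Qed.

Lemma sum_sqr_vtx0 (x : {ffun I -> R}) :
  \sum_j (x j - vtx finset.set0 j) ^+ 2 = \sum_j x j ^+ 2.
Proof. by apply: eq_bigr => j _; rewrite ffunE finset.in_set0 subr0. Qed.

(* A point of a cube on the vertices of types in [K] is determined by its
   distances to the vertex of type set0 and to those of types [set i]. *)
Lemma hat_bpt f g c : f (bpt g c) = bpt (hat f g) c.
Proof.
have [fc fe fv] := aut0P f.
have [K sK cK] : in_chamber e (val c) by case: c => x xP; exact/asboolP.
have [A [cA Ag Ac Ap]] := cube_bpt g sK cK.
have fA p : A p -> exists d, f p = bpt (hat f g) d.
  move=> Ap'; apply: (@cube_base (f @` A)); first by rewrite -fc.
    by exists (base g) => //; rewrite hatE.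
  by exists p.
have [d dE] := fA _ Ac; rewrite dE; congr bpt; apply: val_inj.
have sqE p q : A p -> A q -> \sum_i (coord (f p) i - coord (f q) i) ^+ 2 =
    \sum_i (coord p i - coord q i) ^+ 2.
  move=> Ap' Aq; have := fe _ _ _ cA Ap' Aq; rewrite /euclid => /eqP.
  by rewrite eqr_sqrt ?sumr_ge0 // => [/eqP //|i _|i _]; exact: sqr_ge0.
have E0 : \sum_i val d i ^+ 2 = \sum_i val c i ^+ 2.
  have := sqE _ _ Ac Ag; rewrite hatE dE !coord_bpt.
  by rewrite !sum_sqr_vtx0.
have EK i : i \in K -> val d i = val c i.
  move=> iK; have := sqE _ _ Ac (Ap _ iK).
  have /fv[h [d' [d'E ->]]] : vertex_of_type [set i]%SET (bpt g (panel i)) by exists g, (panel i).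
  rewrite dE !coord_bpt d'E !sum_sqr_vtx1 E0; lra.
apply/ffunP => i; have [/EK//|iK] := boolP (i \in K).
have cK0 j : j \notin K -> val c j = 0 by case: (cK j).
rewrite cK0 //; apply/eqP; rewrite -sqrf_eq0; apply/eqP.
move: i iK; apply: psumr_eq0P => [i _|]; first exact: sqr_ge0.
(* Cancelling the coordinates in [K] leaves a vanishing sum of squares of the others. *)
move: E0; rewrite (bigID (mem K)) /= [in RHS](bigID (mem K)) /=.
rewrite (eq_bigr (fun i => val c i ^+ 2)) => [|i /EK-> //].
rewrite [X in _ = _ + X]big1 => [|i /cK0->]; last by rewrite expr0n.
by move=> /addrI.
Qed.

(** The chambers of a panel share its vertex of type [[set i]], and [f] sends that vertex to one of
    the same type. *)
Lemma hat_panel f g i (a : G i) : exists b : G i,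
  hat f (g * gp_inj e a)%g = (hat f g * gp_inj e b)%g.
Proof.
have : bpt g (panel i) = bpt (g * gp_inj e a)%g (panel i).
  by apply/bptP; split=> //; rewrite ones_vtx mulKg; apply: gp_sub_inj; exact: set11.
move=> /(congr1 f); rewrite !hat_bpt => /bptP[_]; rewrite ones_vtx.
by move=> /gp_sub_set1[b bE]; exists b; rewrite -bE mulKVg.
Qed.

Lemma hat_word f g w : exists w', map tag w' = map tag w /\
  hat f (g * gp_word e w)%g = (hat f g * gp_word e w')%g.
Proof.
elim: w g => [|[i a] w IH] g; first by exists [::]; rewrite gp_word_nil !mulg1.
rewrite gp_word_cons mulgA; have [w' [tw' ->]] := IH (g * gp_inj e a)%g.
have [b ->] := hat_panel f g a; exists (lett b :: w').
by rewrite /= tw' gp_word_cons mulgA.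
Qed.

Lemma hat_sub f J g h : gp_sub J (g^-1 * h)%g -> gp_sub J ((hat f g)^-1 * hat f h)%g.
Proof.
move=> /gp_sub_word[w wJ gh]; have [w' [tw' E]] := hat_word f g w.
apply/gp_sub_word; exists w'.
  by move: wJ; rewrite -!(all_map tag (mem J)) tw'.
by rewrite -[h](mulKVg g) gh E mulKg.
Qed.

Lemma hat_near f n g h : near n g h -> near n (hat f g) (hat f h).
Proof.
move=> [w wn ->]; have [w' [tw' ->]] := hat_word f g w; exists w' => //.
by rewrite -(size_map tag) tw' size_map.
Qed.

Lemma hat1 g : hat 1%g g = g.
Proof. by apply: base_inj; rewrite -hatE. Qed.

Lemma hatM f f' g : hat (f * f')%g g = hat f (hat f' g).
Proof. by apply: base_inj; rewrite -!hatE. Qed.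

Lemma hatK f : cancel (hat f) (hat f^-1%g).
Proof. by move=> g; rewrite -hatM mulVg hat1. Qed.

Lemma hatVK f : cancel (hat f^-1%g) (hat f).
Proof. by move=> g; rewrite -hatM mulgV hat1. Qed.

Lemma hat_ext f f' : hat f =1 hat f' -> f = f'.
Proof. by move=> E; apply: aut0_eqP => p; rewrite -[p]breprK !hat_bpt E. Qed.

Lemma hat_lmul g h : hat (lmul R e G g) h = (g * h)%g.
Proof. by apply: base_inj; rewrite -hatE; exact: lmul_bpt. Qed.

(** * Automorphisms induced by panel-preserving bijections of Gamma *)

Definition panel_map (chi : Gam -> Gam) := forall g i (a : G i), exists b : G i,
  chi (g * gp_inj e a)%g = (chi g * gp_inj e b)%g.

Definition lift (chi : Gam -> Gam) p : building := bpt (chi (brepr p).1) (brepr p).2.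

Lemma panel_map_sub chi J g h : panel_map chi ->
  gp_sub J (g^-1 * h)%g -> gp_sub J ((chi g)^-1 * chi h)%g.
Proof.
move=> chiP gh; rewrite -[h](mulKVg g).
move: (g^-1 * h)%g gh => {h}; apply: gp_sub_ind.
  by rewrite mulg1 mulVg; exact: gp_sub1.
move=> h i a iJ; rewrite mulgA; have [b ->] := chiP (g * h)%g i a.
by rewrite mulgA => IH; exact: gp_subM_inj.
Qed.

Lemma lift_bpt chi g c : panel_map chi -> lift chi (bpt g c) = bpt (chi g) c.
Proof.
move=> chiP; have /bptP[E H] := breprK (bpt g c).
by apply/bptP; split=> //; exact: panel_map_sub.
Qed.

Lemma liftK chi chi' : panel_map chi -> panel_map chi' -> cancel chi chi' ->
  cancel (lift chi) (lift chi').
Proof. by move=> chiP chi'P K p; rewrite -[p]breprK !lift_bpt // K. Qed.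

Lemma lift_cube chi A : panel_map chi -> cube A -> cube (lift chi @` A).
Proof.
move=> chiP [k [J [K [JK sK ->]]]]; exists (chi k), J, K; split=> //.
by rewrite image_comp; apply: eq_imagel => c _ /=; rewrite lift_bpt.
Qed.

Lemma lift_vertex chi J p : panel_map chi -> vertex_of_type J p -> vertex_of_type J (lift chi p).
Proof. by move=> chiP [k [c [cJ ->]]]; exists (chi k), c; rewrite lift_bpt. Qed.

Lemma lift_coord chi p : panel_map chi -> coord (lift chi p) = coord p.
Proof. by move=> chiP; rewrite -[p in LHS]breprK lift_bpt // coord_bpt. Qed.

Lemma is_aut0_lift phi psi : panel_map phi -> panel_map psi -> cancel phi psi ->
  is_aut0 (lift phi).
Proof.
move=> phiP psiP phiK; have phi_psi := liftK phiP psiP phiK.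
split=> [A|A p q _ _ _|J p].
- split=> [/(lift_cube phiP)//|/(lift_cube psiP)].
  rewrite image_comp (_ : _ \o _ = idfun) ?image_id //.
  by apply/funext => p; exact: phi_psi.
- by rewrite /euclid !lift_coord.
by split=> [/(lift_vertex phiP)//|/(lift_vertex psiP)]; rewrite phi_psi.
Qed.

(** A panel map sends cosets of Gamma_J into cosets of Gamma_J, so letting it act on the group
    component of points is well defined; the inverse gives the converse halves of [is_aut0]. *)
Lemma hat_surj phi psi : panel_map phi -> panel_map psi ->
  cancel phi psi -> cancel psi phi -> exists f, hat f =1 phi.
Proof.
move=> phiP psiP phiK psiK.
exists (Aut0 (liftK phiP psiP phiK) (liftK psiP phiP psiK) (is_aut0_lift phiP psiP phiK)) => g.
by apply: base_inj; rewrite -hatE /= lift_bpt.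
Qed.

End Chambers.

(** * The length metric *)

Section Metric.
Variables (R : realType) (I : finType) (e : rel I) (G : I -> finGroupType).
Local Notation Gam := (graph_product e G).
Local Notation chamber := (chamber R e).
Local Notation building := (building R e G).
Local Notation aut0 := (aut0 R e G).
Local Notation vtx := (@vtx R I).
Implicit Types (g h : Gam) (c d x y : chamber) (p q : building) (f : aut0) (J K : {set I}).
Implicit Types (s u v : seq building).
Local Open Scope ring_scope.

Lemma euclid_ge0 p q : 0 <= euclid p q.
Proof. exact: sqrtr_ge0. Qed.

Lemma euclid_sym p q : euclid p q = euclid q p.
Proof. by rewrite /euclid; congr Num.sqrt; apply: eq_bigr => i _; rewrite -sqrrN opprB. Qed.

Lemma chamber_itv c i : 0 <= val c i <= 1.
Proof.
have [K _ /(_ i)[]//] : in_chamber e (val c) by case: c => z zP; exact/asboolP.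
Qed.

(** A convenient upper bound for sqrt [#|I|], hence for the diameter of every cube. *)
Definition mesh : R := #|I|%:R + 1.

Lemma mesh_ge0 : 0 <= mesh.
Proof. by rewrite addr_ge0. Qed.

Lemma euclid_le g c h d : euclid (bpt (G := G) g c) (bpt h d) <= mesh.
Proof.
rewrite euclid_bpt -[leRHS]ger0_norm ?mesh_ge0// -sqrtr_sqr ler_wsqrtr //.
apply: (@le_trans _ _ (\sum_(i : I) 1)).
  apply: ler_sum => i _; have := chamber_itv c i; have := chamber_itv d i; nra.
by rewrite sumr_const /mesh -[_ *+ _]/(#|I|%:R); have := ler0n R #|I|; nra.
Qed.

Lemma euclid_coord g c h d i : `|val d i - val c i| <= euclid (bpt (G := G) g c) (bpt h d).
Proof.
rewrite euclid_bpt -sqrtr_sqr ler_wsqrtr // (bigD1 i) //= -[in leRHS]sqrrN opprB lerDl.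
by apply: sumr_ge0 => j _; exact: sqr_ge0.
Qed.

Lemma string_length_ge0 p s : 0 <= string_length p s.
Proof. by elim: s p => //= q s IH p; rewrite addr_ge0 ?euclid_ge0. Qed.

Lemma is_string_cat p s u : is_string p (s ++ u) <-> is_string p s /\ is_string (last p s) u.
Proof.
elim: s p => [|q s IH] p /=; first by split=> [|[]].
by rewrite IH; split=> [[? [? ?]]|[[? ?] ?]].
Qed.

Lemma string_length_cat p s u :
  string_length p (s ++ u) = string_length p s + string_length (last p s) u.
Proof. by elim: s p => [|q s IH] p /=; rewrite ?add0r// IH addrA. Qed.

Lemma string_rev p s : is_string p s -> exists u,
  [/\ is_string (last p s) u, last (last p s) u = p &
      string_length (last p s) u = string_length p s].
Proof.
elim: s p => [|q s IH] p /=; first by exists [::].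
move=> [[A [cA Ap Aq]] /IH[u [su lu nu]]]; exists (rcons u p).
rewrite -cats1 last_cat string_length_cat lu /= nu addr0 addrC euclid_sym.
by split=> //; apply/is_string_cat; split=> //=; rewrite lu; split=> //; exists A.
Qed.

Lemma dist_le p s : is_string p s -> building_dist R e G p (last p s) <= string_length p s.
Proof.
move=> sp; apply: ge_inf; last by exists s.
by exists 0 => _ [u _ <-]; exact: string_length_ge0.
Qed.

Lemma dist_approx p s eps : 0 < eps -> is_string p s -> exists u,
  [/\ is_string p u, last p u = last p s &
      string_length p u < building_dist R e G p (last p s) + eps].
Proof.
move=> eps0 sp; have [|_ [u [su lu] <-] ul] := @inf_adherent R
  [set string_length p u | u in [set u | is_string p u /\ last p u = last p s]] eps eps0.
  split; first by exists (string_length p s), s.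
  by exists 0 => _ [u _ <-]; exact: string_length_ge0.
by exists u.
Qed.

Definition chdist g h : R := building_dist R e G (base R g) (base R h).

(** Each letter is realized by passing through the vertex of a panel, at distance 1 from the centers
    of both chambers; hence the factor 2. *)
Lemma near_string n g h : near n g h -> exists s, [/\ is_string (base R g) s,
  last (base R g) s = base R h & string_length (base R g) s <= 2 * n%:R].
Proof.
move=> [w wn ->]; elim: w n g wn => [|[i a] w IH] n g wn.
  by exists [::]; rewrite gp_word_nil mulg1 /= mulr_ge0.
case: n wn => // n wn; have [s [ss ls ns]] := IH n (g * gp_inj e a)%g wn.
exists [:: bpt g (panel R e i), base R (g * gp_inj e a)%g & s].
rewrite gp_word_cons mulgA; split=> //=.
  have iK : i \in [set i]%SET by rewrite set11.
  have gg : bpt g (panel R e i) = bpt (g * gp_inj e a)%g (panel R e i).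
    by apply/bptP; rewrite ones_vtx mulKg; split=> //; exact: gp_sub_inj.
  have iF : cube_face finset.set0 [set i]%SET (val (panel R e i)) by exact: vtx_face.
  have [A [cA Ag Ap _]] := cube_bpt g (@spherical1 _ e i) iF.
  have [B [cB Bg Bp _]] := cube_bpt (g * gp_inj e a)%g (@spherical1 _ e i) iF.
  by split; [exists A|split=> //; exists B; rewrite gg].
have one (k l : Gam) : euclid (bpt k (center R e)) (bpt l (panel R e i)) = 1.
  rewrite euclid_bpt sum_sqr_vtx1 big1 ?add0r; last first.
    by move=> j _; rewrite ffunE finset.in_set0 /= expr0n.
  by rewrite ffunE finset.in_set0 /= mulr0 oppr0 add0r sqrtr1.
by rewrite [X in _ + (X + _)]euclid_sym !one -addn1 natrD; move: ns; lra.
Qed.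

Lemma chdist_near n g h : near n g h -> chdist g h <= 2 * n%:R.
Proof.
by move=> /near_string[s [ss ls ns]]; rewrite /chdist -ls; exact: le_trans (dist_le ss) ns.
Qed.

Lemma chdist_string g h eps : 0 < eps -> exists s, [/\ is_string (base R g) s,
  last (base R g) s = base R h & string_length (base R g) s < chdist g h + eps].
Proof.
move=> eps0; have [n /near_string[s [ss ls _]]] := near_ex g h.
by have := dist_approx eps0 ss; rewrite ls.
Qed.

Lemma chdist_le g h s : is_string (base R g) s -> last (base R g) s = base R h ->
  chdist g h <= string_length (base R g) s.
Proof. by move=> ss ls; rewrite /chdist -ls; exact: dist_le. Qed.

Lemma chdist_ge0 g h : 0 <= chdist g h.
Proof.
apply: lb_le_inf; last by move=> _ [s _ <-]; exact: string_length_ge0.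
have [s [ss ls _]] := chdist_string g h ltr01.
by exists (string_length (base R g) s), s.
Qed.

Lemma chdist_sym g h : chdist g h = chdist h g.
Proof.
suff le k l : chdist k l <= chdist l k by apply/eqP; rewrite eq_le !le.
apply/ler_addgt0Pr => eps /(chdist_string l k)[s [/string_rev[u [su lu nu]] ls sl]].
apply: le_trans (ltW sl); rewrite -nu; move: su lu; rewrite ls; exact: chdist_le.
Qed.

Lemma chdist_triangle h g k : chdist g k <= chdist g h + chdist h k.
Proof.
apply/ler_addgt0Pr => eps eps0.
have eps2 : 0 < eps / 2 by lra.
have [s [ss ls ns]] := chdist_string g h eps2.
have [u [su lu nu]] := chdist_string h k eps2.
apply: (@le_trans _ _ (string_length (base R g) (s ++ u))).
  by apply: chdist_le; [apply/is_string_cat; rewrite ls|rewrite last_cat ls].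
rewrite string_length_cat ls; lra.
Qed.

Lemma chdist_refl g : chdist g g = 0.
Proof.
apply/eqP; rewrite eq_le chdist_ge0 andbT.
by have := chdist_near (near_refl g); rewrite mulr0.
Qed.

(** Contains [ones] of every point whose coordinates are all within less than 1/2 of those of [x],
    and is still spherical. *)
Definition upper_half x : {set I} := [set i | 2^-1 < val x i]%SET.

Lemma near_upper_half x g h : gp_sub (upper_half x) (g^-1 * h)%g -> near #|I| g h.
Proof.
have [K sK xK] : in_chamber e (val x) by case: x => z zP; exact/asboolP.
have inK k : k \in upper_half x -> k \in K.
  rewrite inE; apply: contraTT => kK; have [_ _ ->//] := xK k.
  by rewrite -leNgt invr_ge0.
have sx : spherical e (upper_half x).
  by move=> i j iU jU ij; apply: sK => //; exact: inK.
move=> /(spherical_near sx) gh; rewrite -[g]mulg1 -[h](mulKVg g).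
by apply: near_mulg; apply: nearW gh; exact: max_card.
Qed.

(* While a string stays within 1/2 of a point [x0], the chambers it visits
   stay in one coset of the finite group Gamma_(upper_half x0); a new coset is
   started each time the length [r] accumulated since [x0] exceeds 1/2. *)
Lemma string_near s g0 x0 g x h (r : R) :
  is_string (bpt g x) s -> last (bpt g x) s = base R h ->
  gp_sub (upper_half x0) (g0^-1 * g)%g ->
  (forall i, `|val x i - val x0 i| <= r) -> r < 2^-1 ->
  exists2 n : nat, near n g0 h &
    n%:R <= #|I|%:R * (1 + 2 * (r + string_length (bpt g x) s)).
Proof.
elim: s g0 x0 g x r => [|q s IH] g0 x0 g x r /=.
  move=> _ /esym/bpt_center <- gsub xr r2; exists #|I|; first exact: near_upper_half gsub.
  have r0 : #|I|%:R * r >= 0.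
    have [i _|I0] := pickP I; last by rewrite eq_card0 // mul0r.
    by rewrite mulr_ge0 // (le_trans _ (xr i)).
  by rewrite addr0; lra.
move=> [[A [[k [J [K [_ _ ->]]]] [y _ gy] [z _ kz]]] sq] lq gsub xr r2.
move: gy => /bptP[yx kg]; subst q y.
have ones_sub : ones (val x) \subset upper_half x0.
  apply/fintype.subsetP => i; rewrite !inE => /eqP x1.
  by have := xr i; rewrite x1 ler_norml; lra.
have {}gsub : gp_sub (upper_half x0) (g0^-1 * k)%g.
  move: kg => /(subgroup_sym (subgroup_gp_sub _))/(gp_subS ones_sub).
  exact: subgroup_trans (subgroup_gp_sub _) gsub.
have zr i := euclid_coord g x k z i.
set d := euclid _ _ in zr *; have d0 : 0 <= d by exact: euclid_ge0.
have [rd|rd] := ltP (r + d) 2^-1.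
  have [i|n gn nb] := IH _ x0 _ _ (r + d) sq lq gsub _ rd; last first.
    by exists n => //; rewrite addrA.
  by have := ler_normD (val z i - val x i) (val x i - val x0 i);
     rewrite addrA subrK; have := zr i; have := xr i; lra.
(* Here [r + d] is at least 1/2. The count restarts at [z], and the at most [#|I|] letters from [g0]
   to [k] are paid for by [2 * (r + d) >= 1]. *)
have [|||n kn nb] := IH k z k z 0 sq lq; last 1 first.
- exists (#|I| + n)%N; first exact: near_trans (near_upper_half gsub) kn.
  rewrite natrD; have := string_length_ge0 (bpt k z) s; have := ler0n R #|I|; nra.
- by rewrite mulVg; exact: gp_sub1.
- by move=> i; rewrite subrr normr0.
by rewrite invr_gt0.
Qed.

(** With [chdist_near], a quasi-isometry between the word metric and the length metric. The 3 is the
    1 of [string_near] plus twice the slack 1 in the choice of a string. *)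
Lemma near_chdist g h :
  exists2 n : nat, near n g h & n%:R <= #|I|%:R * (3 + 2 * chdist g h).
Proof.
have [s [ss ls ns]] := chdist_string g h ltr01.
have [|||n gn nb] := @string_near s g (center R e) g (center R e) h 0 ss ls.
- by rewrite mulVg; exact: gp_sub1.
- by move=> i; rewrite subrr normr0.
- by rewrite invr_gt0.
exists n => //; apply: le_trans nb _; apply: ler_wpM2l => //; lra.
Qed.

Lemma string_map (f : building -> building) p s :
  (forall A, cube A -> cube (f @` A)) -> is_string p s -> is_string (f p) (map f s).
Proof.
move=> fc; elim: s p => //= q s IH p [[A [cA Ap Aq]] sq]; split; last exact: IH.
by exists (f @` A); split; [exact: fc|exists p|exists q].
Qed.

Lemma string_length_map (f : building -> building) p s :
  (forall p, coord (f p) = coord p) -> string_length (f p) (map f s) = string_length p s.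
Proof. by move=> fc; elim: s p => //= q s IH p; rewrite IH /euclid !fc. Qed.

(** The string is cut at the start of the segment containing length [t], with a detour to the center
    of a chamber there. The detour and the segment each cost at most [mesh]. *)
Lemma string_split (T : set Gam) p s t :
  is_string p s -> (forall q, q \in p :: s -> exists g x, T g /\ q = bpt g x) ->
  0 <= t <= string_length p s ->
  exists g u v, [/\ T g, is_string p u /\ last p u = base R g,
    is_string (base R g) v /\ last (base R g) v = last p s,
    string_length p u <= t + 2 * mesh &
    string_length (base R g) v <= string_length p s - t + 2 * mesh].
Proof.
have mesh0 := mesh_ge0.
have start q k x : q = bpt k x -> [/\ is_string q [:: base R k], is_string (base R k) [:: q],
    euclid q (base R k) <= mesh & euclid (base R k) q <= mesh].
  move=> ->; rewrite !euclid_le.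
  have [K sK xK] : in_chamber e (val x) by case: x => z zP; exact/asboolP.
  have [A [cA Ak Ax _]] := cube_bpt k sK xK.
  by split=> //; split=> //; exists A.
elim: s p t => [|q s IH] p t /= sp sT tl.
  have [g [x [Tg pE]]] := sT p (mem_head _ _); have [pg gp pgm gpm] := start _ _ _ pE.
  by exists g, [:: base R g], [:: p]; split=> //=; rewrite ?addr0; lra.
have [tq|tq] := leP t (euclid p q).
  have [g [x [Tg pE]]] := sT p (mem_head _ _); have [pg gp pgm gpm] := start _ _ _ pE.
  have pq : euclid p q <= mesh.
    have [[_ [[k [J [K [_ _ ->]]]] [y _ <-] [z _ <-]]] _] := sp; exact: euclid_le.
  exists g, [:: base R g], [:: p, q & s]; split=> //=.
  - by split=> //; split=> //; case: gp.
  - by rewrite ?addr0; lra.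
  lra.
case: sp => pq sq; have [||g [u [v [Tg [su lu] [sv lv] lbu lbv]]]] := IH q (t - euclid p q) sq.
- by move=> q' q's; apply: sT; rewrite inE q's orbT.
- lra.
exists g, (q :: u), v; split=> //=; lra.
Qed.

(* The homomorphism Gamma -> Gamma_J killing the other factors induces a
   1-Lipschitz retraction of the building onto the chambers of [b Gamma_J], so
   almost shortest strings between these can be taken among them. *)
Lemma coset_interpolation b J g h t : gp_sub J (b^-1 * g)%g -> gp_sub J (b^-1 * h)%g ->
  0 <= t <= chdist g h -> exists k : Gam, [/\ gp_sub J (b^-1 * k)%g,
    chdist g k <= t + 2 * mesh & chdist k h <= chdist g h - t + 2 * mesh + 1].
Proof.
move=> gJ hJ tle; have [s [ss ls ns]] := chdist_string g h ltr01.
pose chi (k : Gam) := (b * gp_retr J (b^-1 * k))%g.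
have chiP : panel_map chi.
  move=> k i a; rewrite /chi mulgA gp_retr_inj.
  case: ifP => _; first by exists a; rewrite mulgA.
  by exists 1%g; rewrite gp_inj1 mulg1.
have chi_id k : gp_sub J (b^-1 * k)%g -> lift chi (base R k) = base R k.
  by move=> kJ; rewrite /base lift_bpt // /chi gp_retr_id // mulKVg.
have : is_string (lift chi (base R g)) (map (lift chi) s).
  by apply: string_map => // A; exact: lift_cube.
have : string_length (lift chi (base R g)) (map (lift chi) s) = string_length (base R g) s.
  by apply: string_length_map => p; exact: lift_coord.
have : last (lift chi (base R g)) (map (lift chi) s) = base R h by rewrite last_map ls chi_id.
rewrite chi_id // => ls' ns' ss'.
have := chdist_le ss' ls'; rewrite ns' => gh.
have [||k [u [v [Tk [su lu] [sv lv] lbu lbv]]]] :=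
  @string_split [set k | gp_sub J (b^-1 * k)%g] _ _ t ss'.
- move=> q qs; have [p ->] : exists p, q = lift chi p.
    move: qs; rewrite inE => /orP[/eqP->|/mapP[p _ ->]]; last by exists p.
    by exists (base R g); rewrite chi_id.
  rewrite -[p]breprK lift_bpt //; exists (chi (brepr p).1), (brepr p).2; split=> //.
  by rewrite /= /chi mulKg; exact: gp_retr_sub.
- by rewrite ns'; lra.
exists k; split=> //; first exact: le_trans (chdist_le su lu) lbu.
have := chdist_le sv (etrans lv ls'); rewrite ns' in lbv; lra.
Qed.

End Metric.

(** * Stability of quasi-geodesics *)

Section Stability.
Variables (R : realType) (X : Type) (D : X -> X -> R).
Local Open Scope ring_scope.
Hypothesis D_ge0 : forall x y, 0 <= D x y.
Hypothesis D_refl : forall x, D x x = 0.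
Hypothesis D_sym : forall x y, D x y = D y x.
Hypothesis D_tri : forall y x z, D x z <= D x y + D y z.
Variable delta : R.
Hypothesis delta_ge0 : 0 <= delta.
Hypothesis four_point : forall x y z w,
  D x z + D y w <= D x y + D z w + 2 * delta \/ D x z + D y w <= D y z + D x w + 2 * delta.
Variables (T : X -> Prop) (c : R).
Hypothesis c_ge0 : 0 <= c.
Hypothesis T_interp : forall p q t, T p -> T q -> 0 <= t <= D p q ->
  exists m, [/\ T m, D p m <= t + c & D m q <= D p q - t + c].

(** The slack 1 guarantees existence, since the infimum of the distances need not be attained. *)
Definition nearest x p := T p /\ forall t, T t -> D x p <= D x t + 1.

Lemma nearest_ex x t0 : T t0 -> exists p, nearest x p.
Proof.
move=> Tt0; have lb : lbound [set D x t | t in T] 0 by move=> _ [t _ <-].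
have [||_ [p Tp <-] pl] := @inf_adherent R [set D x t | t in T] 1.
- exact: ltr01.
- by split; [exists (D x t0), t0|exists 0].
exists p; split=> // t Tt; apply: le_trans (ltW pl) _; rewrite lerD2r.
by apply: ge_inf; [exists 0|exists t].
Qed.

(** [C1] is the error in [nearest_gate]; adding two such inequalities and applying the four-point
    condition produces [C2]. *)
Let C1 := 2 * c + 4 * delta + 3.
Let C2 := 2 * C1 + 2 * delta.

(** A point [m] of [T] slightly beyond [p] towards [t] is hardly closer to [x] than [p], so the
    four-point condition forces the way from [x] to [t] to pass near [p]. *)
Lemma nearest_gate x p t : nearest x p -> T t -> D x p + D p t <= D x t + C1.
Proof.
move=> [Tp pP] Tt; have [small|large] := leP (D p t) (2 + c + 2 * delta).
  by have := pP _ Tt; rewrite /C1; have := c_ge0; have := delta_ge0; lra.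
(* This length exceeds [1 + c + 2 * delta], which rules out the first alternative of the four-point
   condition for [x], [p], [m], [t]. *)
have s0 : 0 <= 2 + c + 2 * delta <= D p t
  by rewrite (ltW large) andbT; have := c_ge0; have := delta_ge0; lra.
have [m [Tm pm mt]] := T_interp Tp Tt s0.
have := pP _ Tm; have := four_point x p m t; rewrite /C1; have := delta_ge0; lra.
Qed.

(* Balls disjoint from [T] project to sets of bounded diameter. *)
Lemma nearest_contract x y p q : nearest x p -> nearest y q -> D x y <= D x p -> D p q <= C2.
Proof.
move=> xp yq xy.
have := nearest_gate xp yq.1; have := nearest_gate yq xp.1.
have := four_point x y q p.
rewrite (D_sym q p) /C2; have := D_ge0 y q; have := D_ge0 p q; have := delta_ge0.
rewrite /C1; lra.
Qed.

Lemma C2_ge0 : 0 <= C2.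
Proof. by rewrite /C2 /C1; have := c_ge0; have := delta_ge0; lra. Qed.

Section Path.
Variables (x p : nat -> X) (E r : R) (n k : nat).
Hypothesis step : forall j, (j < k)%N -> D (x j) (x j.+1) <= E.
Hypothesis pP : forall j, nearest (x j) (p j).
Hypothesis n_gt0 : (0 < n)%N.
Hypothesis r_ge : E * n%:R <= r.
Hypothesis E_ge0 : 0 <= E.

Lemma path_dist u m : (u + m <= k)%N -> D (x u) (x (u + m)%N) <= E * m%:R.
Proof.
elim: m => [|m IH]; first by rewrite addn0 D_refl mulr0.
rewrite addnS => umk; have := IH (ltnW umk); have := step umk.
by have := D_tri (x (u + m)%N) (x u) (x (u + m).+1); rewrite -natr1; lra.
Qed.

(** Outside the [r]-neighbourhood of [T], [n] steps cover at most [E * n <= r], so by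
    [nearest_contract] they move the projection by at most [C2]. The path is cut into blocks of [n]
    steps. *)
Lemma far_contract u m : (u + m <= k)%N ->
  (forall w, (u <= w < u + m)%N -> r < D (x w) (p w)) ->
  D (p u) (p (u + m)%N) * n%:R <= C2 * (m%:R + n%:R).
Proof.
have C20 := C2_ge0; have n0 : 0 < n%:R :> R by rewrite ltr0n.
have [N] := ubnP m; elim: N u m => // N IH u m mN umk far.
have [->|m0] := eqVneq m 0%N.
  by rewrite addn0 D_refl mul0r mulr_ge0 // addr_ge0.
have near_step l : (l <= n)%N -> (l <= m)%N -> D (p u) (p (u + l)%N) <= C2.
  move=> ln lm; apply: (nearest_contract (pP u) (pP _)).
  apply: (le_trans (path_dist _)); first by rewrite (leq_trans _ umk) // leq_add2l.
  apply: (le_trans _ (ltW (far u _))); last by rewrite leqnn -[ltnLHS]addn0 ltn_add2l lt0n.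
  by apply: le_trans r_ge; apply: ler_wpM2l => //; rewrite ler_nat.
have [mn|nm] := leqP m n.
  have := near_step m mn (leqnn m).
  have := ler0n R m; have := D_ge0 (p u) (p (u + m)%N); nra.
have := near_step n (leqnn n) (ltnW nm).
have {}IH := IH (u + n)%N (m - n)%N.
rewrite -addnA subnKC ?(ltnW nm) // in IH.
have {}IH : D (p (u + n)%N) (p (u + m)%N) * n%:R <= C2 * ((m - n)%:R + n%:R).
  apply: IH => //; first by rewrite -ltnS (leq_trans _ mN) // ltnS ltn_subrL n_gt0 lt0n.
  by move=> w /andP[uw wm]; apply: far; rewrite wm (leq_trans _ uw) ?leq_addr.
rewrite natrB ?(ltnW nm) // in IH.
have := D_tri (p (u + n)%N) (p u) (p (u + m)%N); nra.
Qed.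

(** [u] begins the run of far points containing [j]. Its predecessor is within [r] of its
    projection; one step and the slack in [nearest] account for [E + 1]. *)
Lemma run_start j : (j <= k)%N -> D (x 0) (p 0) <= r -> r < D (x j) (p j) ->
  exists u, [/\ (u <= j)%N, D (x u) (p u) <= r + E + 1 &
    forall w, (u <= w <= j)%N -> r < D (x w) (p w)].
Proof.
move=> jk x0; elim: j jk => [|j IH] jk xj; first by move: x0; rewrite leNgt xj.
have [small|large] := leP (D (x j) (p j)) r.
  exists j.+1; split=> // [|w]; last by rewrite -eqn_leq => /eqP <-.
  have [Tp _] := pP j; have := (pP j.+1).2 _ Tp; have := step jk; rewrite D_sym.
  have := D_tri (x j) (x j.+1) (p j); lra.
have [u [uj xu far]] := IH (ltnW jk) large.
exists u; split=> // [|w /andP[uw]]; first exact: leqW.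
by rewrite leq_eqVlt => /orP[/eqP->//|wj]; apply: far; rewrite uw.
Qed.

Lemma run_end j : (j <= k)%N -> D (x k) (p k) <= r -> r < D (x j) (p j) ->
  exists b, [/\ (j <= b <= k)%N, D (x b) (p b) <= r &
    forall w, (j <= w < b)%N -> r < D (x w) (p w)].
Proof.
move=> jk xk xj; have exb : exists b, (j <= b)%N && (D (x b) (p b) <= r).
  by exists k; rewrite jk.
case: (ex_minnP exb) => b /andP[jb xb] bmin; exists b; split=> //.
  by rewrite jb bmin // jk.
move=> w /andP[jw wb]; rewrite ltNge; apply/negP => xw.
by have := bmin w; rewrite jw xw leqNgt wb => /(_ isT).
Qed.

Variables (A B : R).
Hypothesis A_ge0 : 0 <= A.
Hypothesis n_ge : 2 * A * C2 <= n%:R.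
Hypothesis quasi_geodesic : forall u v, (u <= v <= k)%N -> (v - u)%:R <= A * D (x u) (x v) + B.

(** Bounds the duration of an excursion: by [n_ge] the projections contribute at most [A * C2] plus
    half the duration to the quasi-geodesic inequality, and that half is absorbed on the left. *)
Let M := 2 * (A * (2 * r + E + 1 + C2) + B).

Lemma path_nearest j : (j <= k)%N -> D (x 0) (p 0) <= r -> D (x k) (p k) <= r ->
  exists2 t, T t & D (x j) t <= E * `|M| + r.
Proof.
(* The sign of [B] is arbitrary, so [M] may be negative; hence the absolute value. *)
move=> jk x0 xk; have EM : 0 <= E * `|M| by rewrite mulr_ge0.
have [small|large] := leP (D (x j) (p j)) r.
  by exists (p j); [case: (pP j)|lra].
have [u [uj xu faru]] := run_start jk x0 large.
have [b [/andP[jb bk] xb farb]] := run_end jk xk large.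
have ub := leq_trans uj jb.
exists (p b); first by case: (pP b).
have C20 := C2_ge0; have n0 : 0 < n%:R :> R by rewrite ltr0n.
have pub : D (p u) (p b) * n%:R <= C2 * ((b - u)%:R + n%:R).
  rewrite -{1}(subnKC ub); apply: far_contract; rewrite subnKC // => w /andP[uw wb].
  by have [jw|wj] := leqP j w; [apply: farb; rewrite jw|apply: faru; rewrite uw ltnW].
have bu : (b - u)%:R <= A * D (x u) (x b) + B by apply: quasi_geodesic; rewrite ub.
have ux : D (x u) (x b) <= D (p u) (p b) + 2 * r + E + 1.
  have := D_tri (p u) (x u) (x b); have := D_tri (p b) (p u) (x b).
  rewrite (D_sym (p b) (x b)); lra.
have buM : (b - u)%:R <= M.
  have pub' : A * D (p u) (p b) <= A * C2 + (b - u)%:R / 2.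
    rewrite -(ler_pM2r n0); apply: (@le_trans _ _ (A * (C2 * ((b - u)%:R + n%:R)))).
      by rewrite -mulrA ler_wpM2l.
    have := n_ge; rewrite -subr_ge0 => /(mulr_ge0 (ler0n R (b - u))); lra.
  have : A * D (x u) (x b) <= A * (D (p u) (p b) + 2 * r + E + 1) by rewrite ler_wpM2l.
  rewrite /M; lra.
have := path_dist (u := j) (m := b - j); rewrite subnKC // => /(_ bk) jbd.
have := D_tri (x b) (x j) (p b).
have : (b - j)%:R <= `|M|.
  by apply: le_trans (ler_norm M); apply: le_trans buM; rewrite ler_nat; exact: leq_sub2l.
move=> /(ler_wpM2l E_ge0); lra.
Qed.

End Path.
End Stability.

(** The Morse lemma for coarsely geodesic sets. The bound [r] is fixed before the path and its
    length. *)
Theorem quasigeodesic_near (R : realType) (X : Type) (D : X -> X -> R)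
  (delta c E A B r0 : R) (T : X -> Prop) :
  (forall x y, 0 <= D x y)%R -> (forall x, D x x = 0)%R -> (forall x y, D x y = D y x) ->
  (forall y x z, D x z <= D x y + D y z)%R ->
  (0 <= delta)%R ->
  (forall x y z w, D x z + D y w <= D x y + D z w + 2 * delta \/
     D x z + D y w <= D y z + D x w + 2 * delta)%R ->
  (0 <= c)%R ->
  (forall p q t, T p -> T q -> 0 <= t <= D p q ->
     exists m, [/\ T m, D p m <= t + c & D m q <= D p q - t + c])%R ->
  (0 <= E)%R -> (0 <= A)%R ->
  exists r : R, forall (x : nat -> X) (k : nat),
    (forall j, (j < k)%N -> D (x j) (x j.+1) <= E)%R ->
    (forall u v, (u <= v <= k)%N -> (v - u)%:R <= A * D (x u) (x v) + B)%R ->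
    (exists2 t, T t & D (x 0%N) t <= r0)%R -> (exists2 t, T t & D (x k) t <= r0)%R ->
    forall j, (j <= k)%N -> exists2 t, T t & (D (x j) t <= r)%R.
Proof.
move=> D0 Dr Ds Dt d0 D4 c0 TP E0 A0.
set C := (2 * (2 * c + 4 * delta + 3) + 2 * delta)%R.
have AC : (0 <= 2 * A * C)%R by rewrite /C; nra.
have [n n0 nC] : exists2 n, (0 < n)%N & (2 * A * C <= n%:R)%R.
  exists (Num.bound (2 * A * C)%R).+1 => //.
  by rewrite -natr1; have := archi_boundP AC; lra.
(* The 1 absorbs the slack of [nearest] at both ends, and [E * n] keeps [n] consecutive steps inside
   a ball of radius [r]. *)
pose r := (`|r0| + 1 + E * n%:R)%R.
exists (E * `|2 * (A * (2 * r + E + 1 + C) + B)| + r)%R => x k st qg [t0 Tt0 xt0] [t1 Tt1 xt1] j jk.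
have [p pP] := choice (fun j => nearest_ex D0 (x j) Tt0).
have rr t i : T t -> (D (x i) t <= r0 -> D (x i) (p i) <= r)%R.
  move=> Tt xt; have En : (0 <= E * n%:R)%R by rewrite mulr_ge0.
  apply: (le_trans ((pP i).2 _ Tt)).
  apply: (@le_trans _ _ (`|r0| + 1)%R); last by rewrite /r lerDl.
  by rewrite lerD2r (le_trans xt) // ler_norm.
apply: (path_nearest D0 Dr Ds Dt d0 D4 c0 TP st pP n0) => //.
- by rewrite /r lerDr addr_ge0.
- exact: rr xt0.
exact: rr xt1.
Qed.

(** * Quasiconvexity of residue stabilizers *)

Section CayleyPaths.
Variables (M : groupType) (S : set M).
Implicit Types (x y : M) (p q : seq M).

Lemma cayley_path_cat x p q :
  cayley_path S x (p ++ q) <-> cayley_path S x p /\ cayley_path S (last x p) q.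
Proof.
elim: p x => [|y p IH] x /=; first by split=> [|[]].
by rewrite IH; split=> [[? [? ?]]|[[? ?] ?]].
Qed.

Lemma cayley_path_step x p j : cayley_path S x p -> (j < size p)%N ->
  let y := last x (take j p) in let z := last x (take j.+1 p) in
  S (y^-1 * z)%g \/ S (z^-1 * y)%g.
Proof.
move=> + jp; rewrite -{1}(cat_take_drop j p) (drop_nth x) // (take_nth x) //.
by move=> /cayley_path_cat[_ /= [+ _]]; rewrite last_rcons.
Qed.

Lemma cayley_path_subgroup (H : set M) x p : subgroup H -> S `<=` H ->
  cayley_path S x p -> H x -> H (last x p).
Proof.
move=> sH SH; have [_ HM HV] := sH; elim: p x => //= y p IH x [xy yp] Hx.
apply: IH => //; case: xy => /SH; first by move=> /(HM _ _ Hx); rewrite mulKVg.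
by move=> /HV; rewrite invgM invgK => /(HM _ _ Hx); rewrite mulKVg.
Qed.

Lemma cayley_path_take x p j : cayley_path S x p -> cayley_path S x (take j p).
Proof. by rewrite -{1}(cat_take_drop j p) => /cayley_path_cat[]. Qed.

(** Replacing the segment from [u] to [v] by [q] gives a competitor with the same ends. *)
Lemma geodesic_sub x p u v q : cayley_geodesic S x p -> (u <= v <= size p)%N ->
  cayley_path S (last x (take u p)) q ->
  last (last x (take u p)) q = last x (take v p) -> (v - u <= size q)%N.
Proof.
move=> [xp geo] /andP[uv vp] uq lq.
have [tv dv] : cayley_path S x (take v p) /\ cayley_path S (last x (take v p)) (drop v p).
  by apply/cayley_path_cat; rewrite cat_take_drop.
have := geo (take u p ++ q ++ drop v p).
rewrite !last_cat lq -last_cat cat_take_drop !size_cat size_drop size_takel; last first.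
  exact: leq_trans vp.
move=> H; have {}H : (size p <= u + (size q + (size p - v)))%N.
  apply: H => //; apply/cayley_path_cat; split; first exact: cayley_path_take.
  by apply/cayley_path_cat; rewrite lq.
lia.
Qed.

End CayleyPaths.

Lemma seq_bound (T : eqType) (P : T -> nat -> Prop) (s : seq T) :
  (forall x m n, (m <= n)%N -> P x m -> P x n) -> (forall x, exists n, P x n) ->
  exists n, forall x, x \in s -> P x n.
Proof.
move=> Pmono Pex; elim: s => [|x s [n IH]]; first by exists 0%N.
have [m Pm] := Pex x; exists (maxn m n) => y; rewrite inE => /orP[/eqP->|/IH].
  by apply: Pmono Pm; exact: leq_maxl.
by apply: Pmono; exact: leq_maxr.
Qed.

(** * The lattice acting on chambers, its generators, and the stabilizers of cosets *)

Section Lattice.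
Variables (R : realType) (I : finType) (e : rel I) (G : I -> finGroupType).
Variables (H : set (aut0 R e G)).
Hypothesis latH : uniform_lattice H.
Local Notation Gam := (graph_product e G).
Local Notation aut0 := (aut0 R e G).
Implicit Types (g h b : Gam) (f : aut0) (J K : {set I}).

Let sH : subgroup H. Proof. by case: latH. Qed.
Let HM f f' : H f -> H f' -> H (f * f')%g. Proof. by case: sH => _ + _; apply. Qed.
Let HV f : H f -> H f^-1%g. Proof. by case: sH => _ _; apply. Qed.

Lemma finite_chamber_orbits : exists s : seq Gam, forall g,
  exists f x, [/\ H f, x \in s & g = hat f x].
Proof.
case: latH => _ _ /finite_seqP[s sE].
(* Orbits of vertices of nonempty type contain no center and contribute only the harmless default
   1. *)
exists [seq xget 1%g [set x | A (base R x)] | A <- s] => g.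
pose A := [set f (base R g) | f in H].
have As : A \in s.
  have : [set` s] A; last by [].
  by rewrite -sE; exists (base R g) => //; exists finset.set0; apply/vertex0P; exists g.
have [f Hf fE] : A (base R (xget 1%g [set x | A (base R x)])).
  apply: (@xgetPex _ 1%g [set x | A (base R x)]); exists g => /=.
  by exists 1%g => //; case: sH.
exists f^-1%g, (xget 1%g [set x | A (base R x)]); split; first exact: HV.
  by apply/mapP; exists A.
by apply: (@base_inj R); rewrite -hatE -fE /= aut0_funK.
Qed.

Lemma finite_fiber g h : finite_set [set f | H f /\ hat f g = h].
Proof.
case: (pselect (exists f, H f /\ hat f g = h)) => [[f0 [Hf0 f0g]]|nf]; last first.
  apply: (@sub_finite_set _ _ set0); last exact: finite_set0.
  by move=> f fP; apply: nf; exists f.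
have fin : finite_set [set f | H f /\ f (base R g) = base R g].
  by case: latH => _ + _; apply; exists finset.set0; apply/vertex0P; exists g.
apply: (@sub_finite_set _ _ [set (f0 * f)%g | f in [set f | H f /\ f (base R g) = base R g]]).
  move=> f [Hf fg]; exists (f0^-1 * f)%g; last by rewrite mulKVg.
  split; first by apply: HM => //; exact: HV.
  by rewrite hatE hatM fg -f0g hatK.
exact: finite_image.
Qed.

Lemma chamber_net : exists N, forall g, exists2 f, H f & near N (hat f 1%g) g.
Proof.
have [s sP] := finite_chamber_orbits.
have [N NP] := @seq_bound _ (fun x n => near n 1%g x) s (fun x m n mn => nearW mn) (near_ex 1%g).
exists N => g; have [f [x [Hf xs ->]]] := sP g.
by exists f => //; apply: hat_near; exact: NP.
Qed.

Section Generators.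
Variable N : nat.
Hypothesis netN : forall g, exists2 f, H f & near N (hat f 1%g) g.

(** The Milnor-Svarc generators: from one orbit point, at most [N] letters to a chamber, one letter
    across a panel, and [N] letters to another orbit point. *)
Definition short_elements : set aut0 := [set f | H f /\ near (N + N).+1 1%g (hat f 1%g)].
Local Notation S := short_elements.

Lemma short_finite : finite_set S.
Proof.
apply: (@sub_finite_set _ _ (\bigcup_(h in [set h | near (N + N).+1 1%g h])
   [set f | H f /\ hat f 1%g = h])); first by move=> f [Hf fN]; exists (hat f 1%g).
by apply: bigcup_finite => [|h _]; [exact: near_finite|exact: finite_fiber].
Qed.

Lemma short_near f f' : near (N + N).+1 1%g (hat (f^-1 * f')%g 1%g) ->
  near (N + N).+1 (hat f 1%g) (hat f' 1%g).
Proof. by move=> /(hat_near f); rewrite -hatM mulKVg. Qed.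

Lemma near_short f f' : H f -> H f' -> near (N + N).+1 (hat f 1%g) (hat f' 1%g) ->
  S (f^-1 * f')%g.
Proof.
move=> Hf Hf' ff'; split; first by apply: HM => //; exact: HV.
by have := hat_near f^-1%g ff'; rewrite hatK hatM.
Qed.

(** The Cayley path shadows the word, one lattice element within [N] of each prefix; a final step
    lands on [f']. *)
Lemma word_path w f f' g : H f -> H f' -> near N (hat f 1%g) g ->
  hat f' 1%g = (g * gp_word e w)%g ->
  exists p, [/\ cayley_path S f p, last f p = f' & (size p <= (size w).+1)%N].
Proof.
elim: w f g => [|a w IH] f g Hf Hf' fg f'E.
  exists [:: f']; split=> //=; split=> //; left; apply: near_short => //.
  rewrite f'E gp_word_nil mulg1; apply: nearW fg; lia.
have [f1 Hf1 f1P] := netN (g * gp_inj e (tagged a))%g.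
have [|p [pP lp sp]] := IH f1 _ Hf1 Hf' f1P.
  by rewrite f'E gp_word_cons mulgA.
exists (f1 :: p); split=> //=; split=> //; left; apply: near_short => //.
have aN : near 1 g (g * gp_inj e (tagged a))%g by exists [:: a]; rewrite ?gp_word1.
have := near_trans (near_trans fg aN) (near_sym f1P).
by rewrite addn1 addSn.
Qed.

Lemma near_path n f f' : H f -> H f' -> near n (hat f 1%g) (hat f' 1%g) ->
  exists p, [/\ cayley_path S f p, last f p = f' & (size p <= n.+1)%N].
Proof.
move=> Hf Hf' [w wn E].
have [|p [pP lp sp]] := word_path Hf Hf' _ E; first exact: nearW (near_refl _).
by exists p; split=> //; apply: leq_trans sp _.
Qed.

Lemma generated_short : generated S = H.
Proof.
apply/seteqP; split; first by apply: subgroup_generated => // f [].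
move=> f Hf; have [n fn] := near_ex (hat (1%g : aut0) 1%g) (hat f 1%g).
have H1 : H 1%g by case: sH.
have [p [pP <- _]] := near_path H1 Hf fn.
apply: (cayley_path_subgroup (generated_subgroup S) (@sub_generated _ S) pP).
by case: (generated_subgroup S).
Qed.

End Generators.

Definition coset_stab b J : set aut0 := [set f | H f /\ gp_sub J (b^-1 * hat f b)%g].

Lemma coset_stab_sub b J g f : H f -> gp_sub J (b^-1 * g)%g ->
  gp_sub J (b^-1 * hat f g)%g -> coset_stab b J f.
Proof.
move=> Hf gJ fgJ; split=> //; apply: subgroup_trans (subgroup_gp_sub _) fgJ _.
by apply: hat_sub; exact: subgroup_sym (subgroup_gp_sub _) gJ.
Qed.

Lemma subgroup_coset_stab b J : subgroup (coset_stab b J).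
Proof.
split=> [|f f' [Hf fb] [Hf' fb']|f [Hf fb]].
- by split; [case: sH|rewrite hat1 mulVg; exact: gp_sub1].
- split; first exact: HM.
  by rewrite hatM; apply: subgroup_trans (subgroup_gp_sub _) fb _; exact: hat_sub.
split; first exact: HV.
rewrite -{1}(hatK f b); apply: hat_sub; exact: subgroup_sym (subgroup_gp_sub _) fb.
Qed.

(** For each orbit representative [x] that some [f0] moves into the coset, any other [f] doing so
    gives f f0^-1 in the stabilizer, so [f0] fixes the bound for [x]. *)
Lemma coset_stab_cocompact b J : exists M, forall t, gp_sub J (b^-1 * t)%g ->
  exists2 f, coset_stab b J f & near M (hat f 1%g) t.
Proof.
have [s sP] := finite_chamber_orbits.
pose P x M := forall f, H f -> gp_sub J (b^-1 * hat f x)%g ->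
  exists2 f', coset_stab b J f' & near M (hat f' 1%g) (hat f x).
have [x m n mn Pm f Hf fx|x|M MP] := @seq_bound _ P s.
- by have [f' f'b f'P] := Pm _ Hf fx; exists f' => //; exact: nearW f'P.
- case: (pselect (exists2 f, H f & gp_sub J (b^-1 * hat f x)%g)) => [[f0 Hf0 f0x]|nf]; last first.
    by exists 0%N => f Hf fx; case: nf; exists f.
  have [M x0M] := near_ex 1%g (hat f0 x); exists M => f Hf fx.
  have E : hat (f * f0^-1)%g (hat f0 x) = hat f x by rewrite hatM hatK.
  exists (f * f0^-1)%g; last by rewrite -E; exact: hat_near.
  apply: (coset_stab_sub _ f0x); last by rewrite E.
  by apply: HM => //; exact: HV.
exists M => t; have [f [x [Hf xs ->]]] := sP t.
exact: MP.
Qed.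

Local Open Scope ring_scope.

Hypothesis hyp : gromov_hyperbolic (building_dist R e G).

Lemma chdist_four_point : exists2 delta : R, 0 <= delta & forall x y z w : Gam,
  chdist R x z + chdist R y w <= chdist R x y + chdist R z w + 2 * delta \/
  chdist R x z + chdist R y w <= chdist R y z + chdist R x w + 2 * delta.
Proof.
have [delta deltaP] := hyp; exists `|delta| => // x y z w.
have := deltaP (base R w) (base R x) (base R y) (base R z).
rewrite /gromov_product /chdist; have dle := ler_norm delta.
by rewrite lerBlDr ge_min => /orP[] d; [left|right]; lra.
Qed.

(** A Cayley geodesic traces a quasi-geodesic of chambers with ends near the coset. The Morse lemma
    keeps it near the coset, and cocompactness then gives nearby elements of the stabilizer. *)
Lemma coset_stab_quasiconvex b J : quasiconvex_in H (coset_stab b J).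
Proof.
have [N netN] := chamber_net.
exists (short_elements N); split; [exact: short_finite|exact: generated_short|].
have [M MP] := coset_stab_cocompact b J.
have [n0 n0P] := near_ex 1%g b.
have [delta delta0 four] := chdist_four_point.
pose T g := gp_sub J (b^-1 * g)%g.
have c0 : 0 <= 2 * mesh R I + 1 by have := mesh_ge0 R I; lra.
have interp (p q : Gam) t : T p -> T q -> 0 <= t <= chdist R p q ->
    exists m, [/\ T m, chdist R p m <= t + (2 * mesh R I + 1) &
      chdist R m q <= chdist R p q - t + (2 * mesh R I + 1)].
  move=> Tp Tq /(coset_interpolation Tp Tq)[m [Tm pm mq]].
  by exists m; split=> //; lra.
have E0 : 0 <= 2 * (N + N).+1%:R :> R by rewrite mulr_ge0.
have A0 : 0 <= 2 * #|I|%:R :> R by rewrite mulr_ge0.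
(* The slope and intercept come from [near_chdist] and the extra step in [near_path]; [2 * n0]
   bounds the distance from the ends to the coset. *)
have [r rP] := quasigeodesic_near (3 * #|I|%:R + 1) (2 * n0%:R) (@chdist_ge0 R I e G)
  (@chdist_refl R I e G) (@chdist_sym R I e G) (@chdist_triangle R I e G)
  delta0 four c0 interp E0 A0.
pose n1 := Num.bound (#|I|%:R * (3 + 2 * `|r|)).
(* [n1] letters lead to the coset and [M] more to an orbit point of the stabilizer; [near_path] adds
   one step. *)
exists (n1 + M).+1 => x p [Hx xJ] geo [Hl lJ] y.
have [xp geoP] := geo.
have Hp q : cayley_path (short_elements N) x q -> H (last x q).
  by move=> xq; apply: cayley_path_subgroup sH _ xq Hx => f [].
have Hk k : H (last x (take k p)) by apply: Hp; exact: cayley_path_take.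
have ends f : coset_stab b J f -> exists2 t, T t & chdist R (hat f 1%g) t <= 2 * n0%:R.
  move=> [Hf fJ]; exists (hat f b) => //.
  by apply: chdist_near; exact: hat_near.
pose xx k : Gam := hat (last x (take k p)) 1%g.
have step j : (j < size p)%N -> chdist R (xx j) (xx j.+1) <= 2 * (N + N).+1%:R.
  move=> jp; apply: chdist_near; have [[_ yz]|[_ zy]] := cayley_path_step xp jp.
    exact: short_near.
  by apply: near_sym; exact: short_near.
have qg u v : (u <= v <= size p)%N ->
    (v - u)%:R <= 2 * #|I|%:R * chdist R (xx u) (xx v) + (3 * #|I|%:R + 1).
  move=> uv; have [n nn nD] := near_chdist R (xx u) (xx v).
  have [q [qP lq sq]] := near_path netN (Hk u) (Hk v) nn.
  have : ((v - u)%:R <= n.+1%:R :> R).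
    by rewrite ler_nat; apply: leq_trans sq; exact: geodesic_sub geo uv qP lq.
  by rewrite -natr1; lra.
move=> yp; have [j jp ->] : exists2 j, (j <= size p)%N & y = last x (take j p).
  case/splitPl: yp => p1 p2 <-; exists (size p1); rewrite ?size_cat ?leq_addr //.
  by rewrite take_size_cat.
have [||t Tt xt] := rP xx (size p) step qg _ _ j jp.
- by apply: ends; rewrite take0.
- by apply: ends; rewrite take_size.
have [n nt nb] := near_chdist R (xx j) t.
have nn1 : (n <= n1)%N.
  rewrite -(ler_nat R); apply: (le_trans nb).
  have nb0 : 0 <= #|I|%:R * (3 + 2 * `|r|) by rewrite mulr_ge0 // addr_ge0 // mulr_ge0.
  apply: le_trans (ltW (archi_boundP nb0)); apply: ler_wpM2l => //.
  by have := ler_norm r; lra.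
have [f fL fM] := MP t Tt.
have [q [qP lq sq]] := near_path netN (Hk j) fL.1 (near_trans (nearW nn1 nt) (near_sym fM)).
by exists q; rewrite lq.
Qed.

End Lattice.

(** * Invariant colourings of walls *)

Section Colorings.
Variables (I : finType) (e : rel I) (G : I -> finGroupType).
Hypotheses (e_sym : symmetric e).
Local Notation Gam := (graph_product e G).
Implicit Types (g h : Gam).

Variable col : forall i, Gam -> G i.
Hypothesis col_adj : forall i g j (a : G j), e i j -> col i (g * gp_inj e a)%g = col i g.
Hypothesis col_inj : forall i g, injective (fun a : G i => col i (g * gp_inj e a)%g).

(** The new right action: the chamber of the panel of [g] whose colour is [col i g * a]. It exists
    because an injective self-map of the finite set [G i] is bijective. *)
Definition twist i g (a : G i) : Gam :=
  (g * gp_inj e (invF (@col_inj i g) (col i g * a)%g))%g.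

Lemma col_twist i g (a : G i) : col i (twist g a) = (col i g * a)%g.
Proof. exact: (f_invF (@col_inj i g)). Qed.

Lemma twist_eq i g (a b : G i) :
  col i (g * gp_inj e b)%g = (col i g * a)%g -> twist g a = (g * gp_inj e b)%g.
Proof. by move=> E; rewrite /twist -E (invF_f (@col_inj i g)). Qed.

Lemma twistP i g (a : G i) : exists2 b : G i,
  twist g a = (g * gp_inj e b)%g & col i (g * gp_inj e b)%g = (col i g * a)%g.
Proof. by exists (invF (@col_inj i g) (col i g * a)%g) => //; exact: col_twist. Qed.

Lemma twist1 i g : twist g (1%g : G i) = g.
Proof. by rewrite (@twist_eq i g 1%g 1%g) ?gp_inj1 ?mulg1. Qed.

Lemma twistM i g (a b : G i) : twist g (a * b)%g = twist (twist g a) b.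
Proof.
have [a' -> aE] := twistP g a; have [b' -> bE] := twistP (g * gp_inj e a')%g b.
rewrite -mulgA -gp_injM; apply: twist_eq.
by rewrite gp_injM mulgA bE aE mulgA.
Qed.

(** Moving along [j] leaves the [i]-colours unchanged and conversely, so both moves can be computed
    from colours at [g]. *)
Lemma twistC i j g (a : G i) (b : G j) : i <> j -> e i j ->
  twist (twist g a) b = twist (twist g b) a.
Proof.
move=> ij eij; have eji : e j i by rewrite e_sym.
have [a' -> aE] := twistP g a; have [b' -> bE] := twistP g b.
have ab : (g * gp_inj e a' * gp_inj e b' = g * gp_inj e b' * gp_inj e a')%g.
  by rewrite -!mulgA gp_injC.
rewrite (@twist_eq j _ b b') ?(@twist_eq i _ a a') //.
- by rewrite -ab !(col_adj _ _ eij).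
by rewrite ab !(col_adj _ _ eji).
Qed.

Definition twist_map g : Gam := gp_act twist 1%g g.

Lemma twist_map1 : twist_map 1%g = 1%g.
Proof. exact: gp_act1 twist1 twistM twistC _. Qed.

Lemma twist_mapM g i (a : G i) : twist_map (g * gp_inj e a)%g = twist (twist_map g) a.
Proof.
by rewrite /twist_map (gp_actM twist1 twistM twistC) (gp_act_inj twist1 twistM twistC).
Qed.

(** The colour increment depends on the current chamber, so the first component remembers the
    chamber while the second accumulates increments. *)
Definition untwist i (p : Gam * Gam) (a : G i) : Gam * Gam :=
  (p.1 * gp_inj e a, p.2 * gp_inj e ((col i p.1)^-1 * col i (p.1 * gp_inj e a)))%g.

Lemma untwist1 i p : untwist p (1%g : G i) = p.
Proof. by case: p => g h; rewrite /untwist /= gp_inj1 mulg1 mulVg gp_inj1 mulg1. Qed.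

Lemma untwistM i p (a b : G i) : untwist p (a * b)%g = untwist (untwist p a) b.
Proof.
case: p => g h; rewrite /untwist /= [gp_inj e (a * b)%g]gp_injM mulgA; congr pair.
by rewrite -[RHS]mulgA -gp_injM mulgA mulgK.
Qed.

Lemma untwistC i j p (a : G i) (b : G j) : i <> j -> e i j ->
  untwist (untwist p a) b = untwist (untwist p b) a.
Proof.
move=> ij eij; have eji : e j i by rewrite e_sym.
case: p => g h; rewrite /untwist /= !(col_adj _ _ eij) !(col_adj _ _ eji).
have ab : (g * gp_inj e a * gp_inj e b = g * gp_inj e b * gp_inj e a)%g.
  by rewrite -!mulgA gp_injC.
have Ei : col i (g * gp_inj e b * gp_inj e a)%g = col i (g * gp_inj e a)%g.
  by rewrite -ab (col_adj _ _ eij).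
have Ej : col j (g * gp_inj e a * gp_inj e b)%g = col j (g * gp_inj e b)%g.
  by rewrite ab (col_adj _ _ eji).
by rewrite Ei Ej ab -![(h * _ * _)%g]mulgA [in RHS]gp_injC // => ?; exact: ij.
Qed.

Definition untwist_map g : Gam := (gp_act untwist (1, 1)%g g).2.

Lemma untwist_map1 : untwist_map 1%g = 1%g.
Proof. by rewrite /untwist_map (gp_act1 untwist1 untwistM untwistC). Qed.

Lemma untwist_map_fst g : (gp_act untwist (1, 1)%g g).1 = g.
Proof.
elim/gp_ind: g => [|g i a IH]; first by rewrite (gp_act1 untwist1 untwistM untwistC).
rewrite (gp_actM untwist1 untwistM untwistC) (gp_act_inj untwist1 untwistM untwistC).
by rewrite /untwist /= IH.
Qed.

Lemma untwist_mapM g i (a : G i) : untwist_map (g * gp_inj e a)%g =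
  (untwist_map g * gp_inj e ((col i g)^-1 * col i (g * gp_inj e a)))%g.
Proof.
rewrite /untwist_map (gp_actM untwist1 untwistM untwistC).
by rewrite (gp_act_inj untwist1 untwistM untwistC) /untwist /= untwist_map_fst.
Qed.

Lemma untwist_mapK : cancel untwist_map twist_map.
Proof.
elim/gp_ind => [|g i a IH]; first by rewrite untwist_map1 twist_map1.
by rewrite untwist_mapM twist_mapM IH; apply: twist_eq; rewrite mulKVg.
Qed.

Lemma twist_mapK : cancel twist_map untwist_map.
Proof.
elim/gp_ind => [|g i a IH]; first by rewrite twist_map1 untwist_map1.
rewrite twist_mapM; have [b -> bE] := twistP (twist_map g) a.
by rewrite untwist_mapM bE IH mulKg.
Qed.

Lemma panel_twist_map : panel_map twist_map.
Proof. by move=> g i a; rewrite twist_mapM; have [b] := twistP (twist_map g) a; exists b. Qed.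

Lemma panel_untwist_map : panel_map untwist_map.
Proof. by move=> g i a; rewrite untwist_mapM; eexists. Qed.

Variable R : realType.
Implicit Types f : aut0 R e G.

(* An automorphism preserving the colours commutes with the twisted right
   action of the graph product, hence is a left multiplication in the new
   coordinates. *)
Lemma color_preserving_lmul f g : (forall i h, col i (hat f h) = col i h) ->
  hat f (twist_map g) = twist_map (untwist_map (hat f 1%g) * g)%g.
Proof.
move=> fcol; elim/gp_ind: g => [|g i a IH].
  by rewrite mulg1 twist_map1 untwist_mapK.
rewrite mulgA !twist_mapM -IH; have [b -> bE] := twistP (twist_map g) a.
have [b' b'E] := hat_panel f (twist_map g) b; rewrite b'E; apply/esym/twist_eq.
by rewrite -b'E !fcol.
Qed.

(** [F] is the automorphism induced by [twist_map], the change from the old coordinates to the new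
    ones. *)
Lemma color_conjugator : exists F : aut0 R e G, forall f,
  (forall i h, col i (hat f h) = col i h) ->
  exists u, (F^-1 * f * F)%g = lmul R e G u.
Proof.
have [F FE] := hat_surj R panel_twist_map panel_untwist_map twist_mapK untwist_mapK.
exists F => f fcol; exists (untwist_map (hat f 1%g)); apply: hat_ext => g.
rewrite hat_lmul !hatM; apply: (can_inj (hatK F)).
by rewrite hatVK !FE; exact: color_preserving_lmul.
Qed.

End Colorings.

(** * An invariant colouring for a group permuting no colours *)

Section WallColors.
Variables (R : realType) (I : finType) (e : rel I) (G : I -> finGroupType).
Hypotheses (e_irr : irreflexive e).
Local Notation Gam := (graph_product e G).
Local Notation aut0 := (aut0 R e G).
Implicit Types (g h b c : Gam) (f : aut0).

Definition nbr i : {set I} := [set j | e i j]%SET.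
Definition star i : {set I} := (i |: nbr i)%SET.

Lemma notin_nbr i : i \notin nbr i.
Proof. by rewrite inE e_irr. Qed.

Lemma gp_coordM i g h : gp_coord i (g * h)%g = (gp_coord i g * gp_coord i h)%g.
Proof.
elim/gp_ind: h => [|h j a IH]; first by rewrite gp_coord1 !mulg1.
have [ij|/eqP ij] := eqVneq i j; last by rewrite mulgA !gp_coord_neq.
by subst j; rewrite mulgA !gp_coord_inj IH mulgA.
Qed.

Lemma star_nbr i g : gp_sub (star i) g -> gp_coord i g = 1%g -> gp_sub (nbr i) g.
Proof.
move=> /gp_sub_cone[k|h [a [hK ->]]].
  by rewrite inE => eik; split=> //; apply/eqP => ik; rewrite ik e_irr in eik.
rewrite gp_coord_inj -[h]mul1g (gp_coord_sub 1%g (notin_nbr i) hK) gp_coord1 !mul1g => ->.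
by rewrite gp_inj1 mulg1.
Qed.

(* [f] does not permute the colours of the [i]-wall through the chamber [b]. *)
Definition fixes_colors f i b : Prop :=
  gp_sub (star i) (b^-1 * hat f b)%g -> gp_sub (nbr i) (b^-1 * hat f b)%g.

Variable N : set aut0.
Hypothesis sN : subgroup N.
Hypothesis fixN : forall f i b, N f -> fixes_colors f i b.

Let N1 : N 1%g. Proof. by case: sN. Qed.
Let NM f f' : N f -> N f' -> N (f * f')%g. Proof. by case: sN => _ + _; apply. Qed.
Let NV f : N f -> N f^-1%g. Proof. by case: sN => _ _; apply. Qed.

Section OneType.
Variable i : I.

Definition wall_rel c c' : Prop := exists2 f, N f & gp_sub (star i) (c'^-1 * hat f c)%g.

Lemma wall_rel_sym c c' : wall_rel c c' -> wall_rel c' c.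
Proof.
move=> [f Nf fc]; exists f^-1%g; first exact: NV.
by rewrite -{1}(hatK f c); apply: hat_sub; exact: subgroup_sym (subgroup_gp_sub _) fc.
Qed.

Lemma wall_rel_trans c c' c'' : wall_rel c c' -> wall_rel c' c'' -> wall_rel c c''.
Proof.
move=> [f Nf fc] [f' Nf' fc']; exists (f' * f)%g; first exact: NM.
by rewrite hatM; apply: subgroup_trans (subgroup_gp_sub _) fc' _; exact: hat_sub.
Qed.

Definition wall_repr c : Gam := xget 1%g [set c' | wall_rel c c'].

Lemma wall_reprP c : wall_rel c (wall_repr c).
Proof.
apply: (@xgetPex _ 1%g [set c' | wall_rel c c']); exists c, 1%g => //.
by rewrite hat1 mulVg; exact: gp_sub1.
Qed.

Lemma wall_repr_eq c c' : wall_rel c c' -> wall_repr c = wall_repr c'.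
Proof.
move=> cc'; congr (xget 1%g); apply/seteqP; split=> d /=.
  by apply: wall_rel_trans; exact: wall_rel_sym.
exact: wall_rel_trans.
Qed.

(** The chamber is moved by some element of [N] to the representative wall of its orbit, where the
    colour is read off as a coordinate in [G i]. *)
Definition wall_color c : G i :=
  gp_coord i ((wall_repr c)^-1 *
    hat (xget 1%g [set f | N f /\ gp_sub (star i) ((wall_repr c)^-1 * hat f c)%g]) c)%g.

(** Two elements of [N] carrying [c'] to the representative wall differ by one stabilizing that
    wall, which fixes its colours by [fixN]; the colour is therefore independent of the choice. *)
Lemma wall_colorE f c c' : N f -> wall_rel c c' ->
  gp_sub (star i) ((wall_repr c)^-1 * hat f c')%g ->
  wall_color c' = gp_coord i ((wall_repr c)^-1 * hat f c')%g.
Proof.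
move=> Nf cc' fc'; rewrite /wall_color -(wall_repr_eq cc').
set f' := xget _ _.
have [Nf' f'c'] : N f' /\ gp_sub (star i) ((wall_repr c)^-1 * hat f' c')%g.
  apply: (@xgetPex _ 1%g [set f | N f /\ gp_sub (star i) ((wall_repr c)^-1 * hat f c')%g]).
  by exists f.
have ff' : gp_sub (nbr i) ((hat f' c')^-1 * hat f c')%g.
  have E : hat f c' = hat (f * f'^-1)%g (hat f' c') by rewrite hatM hatK.
  rewrite E; apply: fixN; first by apply: NM => //; exact: NV.
  rewrite -E; apply: subgroup_trans (subgroup_gp_sub _) _ fc'.
  exact: subgroup_sym (subgroup_gp_sub _) f'c'.
have := gp_coord_sub ((wall_repr c)^-1 * hat f' c')%g (notin_nbr i) ff'.
by rewrite -mulgA mulKVg.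
Qed.

Lemma wall_color_hat f c : N f -> wall_color (hat f c) = wall_color c.
Proof.
move=> Nf; have [f' Nf' f'c] := wall_reprP c.
have cc : wall_rel c c by exists 1%g => //; rewrite hat1 mulVg; exact: gp_sub1.
have cfc : wall_rel c (hat f c) by exists f => //; rewrite mulVg; exact: gp_sub1.
rewrite (wall_colorE Nf' cc f'c).
have E : hat (f' * f^-1)%g (hat f c) = hat f' c by rewrite hatM hatK.
by rewrite (@wall_colorE (f' * f^-1)%g c) ?E //; apply: NM => //; exact: NV.
Qed.

(** Chambers adjacent along a type in [star i] lie in the same wall, so a single [f] computes both
    colours. *)
Lemma wall_color_panel c j (a : G j) : j \in star i -> exists (f : aut0) (b : G j),
  [/\ N f, wall_color c = gp_coord i ((wall_repr c)^-1 * hat f c)%g,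
   hat f (c * gp_inj e a)%g = (hat f c * gp_inj e b)%g &
   wall_color (c * gp_inj e a)%g = gp_coord i ((wall_repr c)^-1 * hat f c * gp_inj e b)%g].
Proof.
move=> ji; have [f Nf fc] := wall_reprP c; have [b bE] := hat_panel f c a.
have cc : wall_rel c c by exists 1%g => //; rewrite hat1 mulVg; exact: gp_sub1.
have cca : wall_rel c (c * gp_inj e a)%g.
  exists 1%g => //; rewrite hat1 invgM -mulgA mulVg mulg1 -gp_injV; exact: gp_sub_inj.
exists f, b; split=> //; first exact: wall_colorE.
rewrite -mulgA -bE; apply: wall_colorE => //.
by rewrite bE mulgA; exact: gp_subM_inj.
Qed.

Lemma wall_color_adj c j (a : G j) : e i j -> wall_color (c * gp_inj e a)%g = wall_color c.
Proof.
move=> eij; have ji : j \in star i by rewrite !inE eij orbT.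
have [f [b [Nf -> _ ->]]] := wall_color_panel c a ji.
by apply: gp_coord_neq => ij; rewrite ij e_irr in eij.
Qed.

Lemma wall_color_inj c : injective (fun a : G i => wall_color (c * gp_inj e a)%g).
Proof.
move=> a a' aa'; have ii : i \in star i by rewrite !inE eqxx.
(* The second chamber is seen from the first. Equal colours make the transported letter [b] trivial,
   and injectivity of [hat f] identifies the chambers. *)
pose d := (a^-1 * a')%g.
have a'E : a' = (a * d)%g by rewrite mulKVg.
have := wall_color_panel (c * gp_inj e a)%g d ii => -[f [b [Nf E1 E2]]].
rewrite -mulgA -gp_injM -a'E -aa' E1 gp_coord_inj -{1}[gp_coord i _]mulg1 => /mulgI b1.
move: E2; rewrite -b1 gp_inj1 mulg1 => /(can_inj (hatK f)).
rewrite -mulgA -gp_injM -a'E => /mulgI/(congr1 (gp_coord i)).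
by rewrite -[gp_inj e a]mul1g -[gp_inj e a']mul1g !gp_coord_inj gp_coord1 !mul1g.
Qed.

End OneType.
End WallColors.

(** * Commensurability *)

Section Commensurability.
Variables (R : realType) (I : finType) (e : rel I) (G : I -> finGroupType).
Hypotheses (e_sym : symmetric e) (e_irr : irreflexive e).
Hypothesis hyp : gromov_hyperbolic (building_dist R e G).
Variable H : set (aut0 R e G).
Hypothesis latH : uniform_lattice H.
Hypothesis sepH : forall L : set (aut0 R e G),
  subgroup L -> L `<=` H -> quasiconvex_in H L -> separable_in H L.
Local Notation Gam := (graph_product e G).
Local Notation aut0 := (aut0 R e G).
Implicit Types (g h b c : Gam) (f : aut0).

Let sH : subgroup H. Proof. by case: latH. Qed.
Let HM f f' : H f -> H f' -> H (f * f')%g. Proof. by case: sH => _ + _; apply. Qed.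
Let HV f : H f -> H f^-1%g. Proof. by case: sH => _ _; apply. Qed.

(** The coordinate in [G i] distinguishes the cosets of the colour stabilizer in the wall
    stabilizer; the former is quasiconvex, hence separable, and [separable_normal] applies. *)
Lemma fix_wall i b : exists N, [/\ subgroup N, finite_index N H, normalized_by N H &
  forall f, N f -> fixes_colors f i b].
Proof.
have sL := subgroup_coset_stab latH b (nbr e i).
have LH : coset_stab H b (nbr e i) `<=` H by move=> f [].
have sep := sepH sL LH (coset_stab_quasiconvex latH hyp b (nbr e i)).
have col : coset_coloring (fun f => gp_coord i (b^-1 * hat f b)%g)
    (coset_stab H b (nbr e i)) (coset_stab H b (star e i)).
  move=> f f' [Hf fb] [Hf' f'b] E; split; first by apply: HM => //; exact: HV.
  have : gp_sub (nbr e i) ((hat f b)^-1 * hat f' b)%g.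
    have -> : ((hat f b)^-1 * hat f' b = (b^-1 * hat f b)^-1 * (b^-1 * hat f' b))%g.
      by rewrite invgM invgK -mulgA mulKVg.
    apply: star_nbr => //; first exact: subgroup_mulVg (subgroup_gp_sub _) fb f'b.
    by apply: (mulgI (gp_coord i (b^-1 * hat f b)%g)); rewrite -gp_coordM mulKVg mulg1.
  by move=> /(hat_sub f^-1%g); rewrite hatK hatM.
have [N [sN fN nN NL]] := separable_normal sH sL LH sep col.
exists N; split=> // f Nf fb; have Hf : H f by case: fN => + _; apply.
by case: (NL f).
Qed.

(** Finitely many pairs of a type and an orbit representative suffice, since a normalized subgroup
    carries the property along orbits of [H]. *)
Lemma fix_walls : exists N, [/\ subgroup N, finite_index N H &
  forall f i b, N f -> fixes_colors f i b].
Proof.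
have [s sP] := finite_chamber_orbits latH.
have [N [sN fN nN NP]] : exists N, [/\ subgroup N, finite_index N H, normalized_by N H &
    forall p, p \in [seq (i, x) | i <- enum I, x <- s] -> forall f, N f -> fixes_colors f p.1 p.2].
  elim: [seq (i, x) | i <- enum I, x <- s] => [|[i b] r [N [sN fN nN NP]]].
    exists H; split=> //; first exact: finite_index_refl.
    by move=> x y Hx Hy; apply: HM => //; apply: HM => //; exact: HV.
  have [M [sM fM nM MP]] := fix_wall i b.
  exists (N `&` M); split; [exact: subgroupI|exact: finite_indexI| |].
    by move=> x y [Nx Mx] Hy; split; [exact: nN|exact: nM].
  move=> p; rewrite inE => /orP[/eqP-> f [_ Mf]|/NP pP f [Nf _]]; [exact: MP|exact: pP].
exists N; split=> // f i b Nf fb; have [h [x [Hh xs bE]]] := sP b.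
have Nf' := nN _ _ Nf Hh.
have ixs : (i, x) \in [seq (i, x) | i <- enum I, x <- s].
  by apply/allpairsP; exists (i, x); rewrite mem_enum.
have xE : hat h^-1%g b = x by rewrite bE hatK.
have fxE : hat h^-1%g (hat f b) = hat (h^-1 * f * h)%g x by rewrite !hatM -bE.
have := NP _ ixs _ Nf'; rewrite /fixes_colors /= -fxE -xE => H'.
have := H' (hat_sub h^-1%g fb) => /(hat_sub h).
by rewrite !hatVK.
Qed.

Lemma orbit_color (N : set aut0) : subgroup N -> finite_index N H ->
  exists (T : finType) (k : Gam -> T), forall g h, k g = k h -> exists2 f, N f & h = hat f g.
Proof.
move=> sN fN; have [T [col colP]] := finite_index_color sN fN.
have [s sP] := finite_chamber_orbits latH.
have [w wP] := choice sP; have [x xP] := choice wP.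
(* With [g] the image of [x g] under [w g], inverses are coloured because [col] separates left
   cosets, whereas [w h * (w g)^-1] must lie in [N]. *)
exists ('I_(size s).+1 * T)%type, (fun g => (inord (index (x g) s), col (w g)^-1%g)).
move=> g h [/(congr1 val)] /=.
have [[Hg xg gE] [Hh xh hE]] := (xP g, xP h).
rewrite !inordK ?ltnS ?index_size // => /(congr1 (nth 1%g s)); rewrite !nth_index // => xx cc.
exists (w h * (w g)^-1)%g.
  by have := colP _ _ (HV Hh) (HV Hg) (esym cc); rewrite invgK.
by rewrite hatM {2}gE hatK xx -hE.
Qed.

Lemma lmulM g h : (lmul R e G g * lmul R e G h)%g = lmul R e G (g * h)%g.
Proof. by apply: hat_ext => k; rewrite hatM !hat_lmul mulgA. Qed.

Lemma lmul1 : lmul R e G 1%g = 1%g.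
Proof. by apply: hat_ext => k; rewrite hat_lmul hat1 mul1g. Qed.

Lemma lmulV g : (lmul R e G g)^-1%g = lmul R e G g^-1%g.
Proof. by apply: (mulgI (lmul R e G g)); rewrite mulgV lmulM mulgV lmul1. Qed.

Lemma subgroup_lmul : subgroup (range (lmul R e G)).
Proof.
split=> [|_ _ [g _ <-] [h _ <-]|_ [g _ <-]].
- by exists 1%g; rewrite // lmul1.
- by exists (g * h)%g; rewrite // lmulM.
by exists g^-1%g; rewrite // lmulV.
Qed.

(** A conjugate of [N] lies in both groups. Its index in Gamma is finite because Gamma is simply
    transitive on chambers and [N] has finitely many orbits of them. *)
Lemma lattice_commensurable : commensurable H (range (lmul R e G)).
Proof.
have [N [sN fN NP]] := fix_walls.
have [F FP] := @color_conjugator I e G e_sym (wall_color N)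
  (wall_color_adj e_irr sN NP) (wall_color_inj e_irr sN NP) R.
have NK : conj_set F^-1%g N `<=` range (lmul R e G).
  move=> _ [f Nf <-]; rewrite invgK.
  have [i h|u ->] := FP f; first exact: wall_color_hat.
  by exists u.
have sN' := subgroup_conj F^-1%g sN; have sH' := subgroup_conj F^-1%g sH.
have NH : conj_set F^-1%g N `<=` conj_set F^-1%g H.
  by move=> x /conj_setP Nx; apply/conj_setP; case: fN => + _; apply.
have NHK : conj_set F^-1%g N `<=` conj_set F^-1%g H `&` range (lmul R e G).
  by move=> x Nx; split; [exact: NH|exact: NK].
have sHK := subgroupI sH' subgroup_lmul.
exists F^-1%g; split; first apply: (finite_index_sub sN' sHK NHK) => [x []//|].
  exact: finite_index_conj.
apply: (finite_index_sub sN' sHK NHK) => [x []//|].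
have [T [k kP]] := orbit_color sN fN.
(* A left multiplication by [g] is coloured by the [N]-orbit of the image of g^-1 under [F];
   inverses again match left cosets. *)
apply: (@color_finite_index _ _ (fun f => k (hat F (hat f^-1%g 1%g)))) => //.
move=> _ _ [g _ <-] [h _ <-] /esym; rewrite !lmulV !hat_lmul !mulg1 => /kP[f Nf E].
have [i c|u uE] := FP f; first exact: wall_color_hat.
exists f; rewrite // invgK uE lmulM; congr lmul.
(* Evaluating at h^-1 yields u h^-1 = g^-1, hence u = g^-1 h. *)
have := congr1 (fun f' => hat f' h^-1%g) uE; rewrite !hatM hat_lmul -E hatK => ->.
by rewrite mulgKV.
Qed.

End Commensurability.

Theorem theorem1p3 (R : realType) (I : finType) (e : rel I)
    (e_sym : symmetric e) (e_irr : irreflexive e)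
    (G : I -> finGroupType)
    (hyp : gromov_hyperbolic (building_dist R e G))
    (H : set (aut0 R e G)) (latH : uniform_lattice H)
    (sepH : forall L : set (aut0 R e G),
       subgroup L -> L `<=` H -> quasiconvex_in H L -> separable_in H L) :
  commensurable H (range (lmul R e G)).
Proof. exact: lattice_commensurable. Qed.
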